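(* Let $f,g\in C^\infty(\mathbb{R}^n)$ be real-valued functions with $\nabla g(x)\neq 0$ for all $x\in g^{-1}(0)$, and put $M:=g^{-1}(0)$, $f_M:=f|_M$. If $\lambda\in\mathbb{R}$ is a $\rho_0$-regular value of $f_M$ at infinity, then there exist a neighborhood $U$ of $\lambda$ and $R>0$ such that $f_M|_{f_M^{-1}(U)}$ is a $C^{\infty}$ trivial fibration on $M$ at infinity; that is, writing $\overline{B(R)}:=\{x\in M : \|x\|\le R\}$, the restriction of $f_M$ to $f_M^{-1}(U)\setminus\overline{B(R)}$ is a $C^\infty$ trivial fibration over $U$.
   Context: $\|\cdot\|$ is the Euclidean norm and $\rho_0:=\|\cdot\|^2|_M$. The Milnor set $\mathcal{M}_0(f_M)\subset M$ of $f_M$ is the critical set of the map $(f_M,\rho_0):M\to\mathbb{R}^2$, i.e. the set of points of $M$ at which the differential of this map has rank less than $2$. A value $\lambda\in\mathbb{R}$ is a $\rho_0$-regular value of $f_M$ at infinity if there exist a neighborhood $U$ of $\lambda$ and a constant $R>0$ such that $x\notin\mathcal{M}_0(f_M)$ for every $x\in f_M^{-1}(U)$ with $\|x\|\ge R$. The restriction of $f_M$ to $f_M^{-1}(U)\setminus\overline{B(R)}$ is a $C^\infty$ trivial fibration over $U$ if there is a $C^\infty$ diffeomorphism $f_M^{-1}(U)\setminus\overline{B(R)}\to \big(f_M^{-1}(\lambda)\setminus\overline{B(R)}\big)\times U$ whose second component is $f_M$ (the fibre may be empty). *)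

(* Defs.v *)
From HB Require Import structures.
From mathcomp Require Import all_boot all_order all_algebra.
From mathcomp Require Import all_classical all_reals all_analysis.

Set Implicit Arguments.
Unset Strict Implicit.
Unset Printing Implicit Defensive.

Import Order.TTheory GRing.Theory Num.Theory.
Import numFieldNormedType.Exports.

Local Open Scope classical_set_scope.
Local Open Scope ring_scope.

Section Smooth.
Variables (R : realType).

Definition iter_derive (V W : normedModType R) (s : seq V) (f : V -> W) :
    V -> W :=
  foldr (fun v (h : V -> W) => fun x => 'D_v h x) f s.

(* [f] is C^oo on the open set [O]: its iterated directional derivatives of
   all orders exist and are continuous on [O].  This is the usual notion when
   [V] is finite-dimensional, the only case used here (R, R^n, R^n * R). *)
Definition smooth_on (V W : normedModType R) (O : set V) (f : V -> W) : Prop :=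
  forall (s : seq V) (x : V), O x ->
    {for x, continuous (iter_derive s f)} /\
    forall v : V, derivable (iter_derive s f) x v.

(* C^oo on an arbitrary subset [A]: near each point of [A], [f] agrees on [A]
   with a C^oo map defined on an open set of the ambient space.  On an
   embedded submanifold this is smoothness for the manifold structure.  The
   values of the total function [f] outside [A] are irrelevant. *)
Definition smooth_in (V W : normedModType R) (A : set V) (f : V -> W) : Prop :=
  forall x, A x -> exists (O : set V) (h : V -> W),
    [/\ open_nbhs x O, smooth_on O h & {in A `&` O, f =1 h}].

Definition diffeomorphism (V W : normedModType R) (A : set V) (B : set W)
    (phi : V -> W) : Prop :=
  exists psi : W -> V,
    [/\ set_fun A B phi, set_fun B A psi,
        {in A, cancel phi psi}, {in B, cancel psi phi} &
        smooth_in A phi /\ smooth_in B psi].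

(* The restriction to [E] of [p] is a C^oo trivial fibration over [U] with
   fibre [F]. *)
Definition trivial_fibration (V : normedModType R) (E F : set V) (U : set R)
    (p : V -> R) : Prop :=
  exists phi : V -> V * R,
    diffeomorphism E (F `*` U) phi /\ {in E, forall x, (phi x).2 = p x}.

End Smooth.

Section Euclidean.
Variables (R : realType) (n : nat).

(* The library's norm on ['rV[R]_n] is the sup norm; it induces the same
   topology as the Euclidean one. *)
Definition enorm (x : 'rV[R]_n) : R := Num.sqrt (\sum_(i < n) x 0 i ^+ 2).

Definition rho0 (x : 'rV[R]_n) : R := enorm x ^+ 2.

Definition gradient (g : 'rV[R]_n -> R) (x : 'rV[R]_n) : 'rV[R]_n :=
  \row_(i < n) 'D_(delta_mx 0 i) g x.

(* [v] is the velocity at [x] of a smooth curve lying in [M]. *)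
Definition tangent (M : set 'rV[R]_n) (x v : 'rV[R]_n) : Prop :=
  exists (I : set R) (c : R -> 'rV[R]_n),
    [/\ open_nbhs 0 I, smooth_on I c, c @` I `<=` M, c 0 = x & derive1 c 0 = v].

(* The differential at [x] of [F|_M : M -> R^m] has rank less than [k].  It is
   [v |-> v *m jacobian F x] restricted to tangent vectors, and its rank is
   the largest rank of a family of images (here, the rows of a matrix). *)
Definition diff_rank_lt (m : nat) (M : set 'rV[R]_n)
    (F : 'rV[R]_n -> 'rV[R]_m) (x : 'rV[R]_n) (k : nat) : Prop :=
  forall (p : nat) (V : 'M[R]_(p, n)), (forall i, tangent M x (row i V)) ->
    (\rank (V *m jacobian F x) < k)%N.

Definition pair_map (f h : 'rV[R]_n -> R) (x : 'rV[R]_n) : 'rV[R]_2 :=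
  \row_(j < 2) [:: f x; h x]`_j.

Definition milnor_set (M : set 'rV[R]_n) (f : 'rV[R]_n -> R) : set 'rV[R]_n :=
  [set x | M x /\ diff_rank_lt M (pair_map f rho0) x 2].

(* In what follows [f_M], the restriction of [f] to [M], is given by the pair
   [M], [f]; thus [f_M^-1(U)] is [M `&` f @^-1` U]. *)
Definition rho0_regular_at_infinity (M : set 'rV[R]_n) (f : 'rV[R]_n -> R)
    (lambda : R) : Prop :=
  exists (U : set R) (r : R), [/\ open_nbhs lambda U, 0 < r &
    forall x, (M `&` f @^-1` U) x -> r <= enorm x -> ~ milnor_set M f x].

Definition cball (M : set 'rV[R]_n) (r : R) : set 'rV[R]_n :=
  [set x | M x /\ enorm x <= r].

End Euclidean.

(* Main.v *)
(* Let D be the part of grad f orthogonal to both grad g and x. On M it is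
   nonzero outside the Milnor set, so far away and over a neighbourhood of
   lambda the field X = D / <D, grad f> is defined; it is tangent to M and to
   the spheres, and f grows at unit speed along it. Preservation of the spheres
   confines each trajectory to a compact set for as long as f stays near lambda,
   so following X for the time lambda - f(x) sends x to the fibre of lambda, and
   flowing back gives the inverse.

   X is neither global nor complete. Trajectories with |x|^2 <= a stay in a
   compact set where <D, grad f> is bounded below, so a compactly supported
   field depending on a agrees with X there; by uniqueness the endpoint does not
   depend on a.

   The flow is smooth in the initial condition because its directional
   derivatives are components of the flow of the tangent field
   (x, v) |-> (Y x, dY(x) v): the time-one maps of all flows, in all dimensions,
   form a class of continuous functions stable under directional derivatives. *)
Require Import Defs.
From HB Require Import structures.
From mathcomp Require Import all_boot all_order all_algebra.
From mathcomp Require Import all_classical all_reals all_analysis.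
From mathcomp Require Import ring lra.

Set Implicit Arguments.
Unset Strict Implicit.
Unset Printing Implicit Defensive.

Import Order.TTheory GRing.Theory Num.Theory.
Import numFieldNormedType.Exports.

Local Open Scope classical_set_scope.
Local Open Scope ring_scope.

(** * Differential calculus on row vectors *)

(** A trajectory of a cut-off field might leave the region where the field agrees with X, which
    would call for a continuation argument. The shape of [field] avoids it: everywhere it is a
    scalar multiple of D, so [g] and [rho0] are constant along all its trajectories, and everywhere
    the derivative of [f] along it lies between 0 and 1, so [f] stays between f(x) and f(x) + t for
    the flow time t. Only then does the lower bound on [rate] apply and identify the field with X. D
    is built without division, hence is smooth on the whole space, even where the vectors involved
    become dependent.

    The parameter a cannot be fixed once and for all, because [rate] may tend to 0 at infinity; near
    a given point it can be held constant, which is how smoothness is obtained. All equations are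
    solved on the unit interval, the flow time entering as a factor of the field. *)

Section DirectionalDerivatives.
Context {R : realType}.
Implicit Types (V W : normedModType R).

Lemma derive_quotient_line V W (g : V -> W) (x v : V) (s : R) :
  (fun h : R => h^-1 *: (((fun s : R => g (s *: v + x)) \o shift s) (h *: 1)
    - g (s *: v + x))) =
  (fun h : R => h^-1 *: ((g \o shift (s *: v + x)) (h *: v) - g (s *: v + x))).
Proof. by apply/funext => h /=; rewrite [h *: 1]mulr1 scalerDl addrA. Qed.

Lemma is_derive_line V W (g : V -> W) (x v : V) (s : R) (dg : W) :
  is_derive (s *: v + x) v g dg -> is_derive s 1 (fun s : R => g (s *: v + x)) dg.
Proof.
by case=> dv dE; split; move: dv dE; rewrite /derivable /derive derive_quotient_line.
Qed.

Lemma is_derive_line0 V W (g : V -> W) (x v : V) (dg : W) :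
  is_derive (0 : R) 1 (fun s : R => g (s *: v + x)) dg -> is_derive x v g dg.
Proof.
rewrite -[in X in _ -> X](add0r x) -(scale0r v).
by case=> dv dE; split; move: dv dE; rewrite /derivable /derive derive_quotient_line.
Qed.

Lemma is_derive_cvgP V W (g : V -> W) (x v : V) (dg : W) :
  is_derive x v g dg <->
  h^-1 *: ((g \o shift x) (h *: v) - g x) @[h --> (0:R)^'] --> dg.
Proof.
split=> [[dv <-]|cv]; first exact: dv.
by split; [apply/cvg_ex; exists dg|exact: cvg_lim].
Qed.

Lemma is_derive_scale V (g : V -> R) (x v : V) (a dg : R) :
  is_derive x v g dg -> is_derive x (a *: v) g (a * dg).
Proof.
rewrite -{1}[x]add0r -(scale0r v) => H; apply: is_derive_line0.
have -> : (fun s : R => g (s *: (a *: v) + x)) =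
    (fun s => g (s *: v + x)) \o (fun s => s * a).
  by apply/funext => s /=; rewrite scalerA.
rewrite mulrC; apply: is_derive1_comp.
  by rewrite mul0r; exact: is_derive_line H.
have -> : *%R^~ a = a \*: (@id R) by apply/funext => s; rewrite mulrC.
by apply: is_derive_eq; rewrite [LHS]mulr1.
Qed.

Lemma MVT_line V (g : V -> R) (x v : V) :
  (forall s : R, derivable g (s *: v + x) v) ->
  exists2 s : R, 0 <= s <= 1 & g (v + x) - g x = 'D_v g (s *: v + x).
Proof.
move=> dg.
have dG (s : R) : is_derive s 1 (fun s : R => g (s *: v + x)) ('D_v g (s *: v + x)).
  exact: is_derive_line (derivableP (dg s)).
have [|c c01] := @MVT_segment R (fun s : R => g (s *: v + x))
    (fun s => 'D_v g (s *: v + x)) 0 1 ler01.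
  apply: derivable_within_continuous => s _.
  by case: (dG s).
rewrite scale1r scale0r add0r subr0 mulr1 => ->.
by exists c => //; move: c01; rewrite in_itv.
Qed.

End DirectionalDerivatives.

(** * Strict differentiability and the chain rule along curves *)

Section RowVectors.
Context {R : realType} {m : nat}.
Implicit Types (x y p : 'rV[R]_m).

Lemma rV_coord_le x (j : 'I_m) : `|x 0 j| <= `|x|.
Proof.
rewrite [leRHS]/Num.Def.normr /= mx_normrE.
exact: (le_bigmax _ (fun ij => `|x ij.1 ij.2|) (0, j)).
Qed.

Lemma rV_norm_le x (e : R) : 0 <= e -> (forall j, `|x 0 j| <= e) -> `|x| <= e.
Proof.
move=> e0 xe; rewrite [leLHS]/Num.Def.normr /= mx_normrE.
by apply: bigmax_le => // -[i j] _ /=; rewrite (ord1 i).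
Qed.

Lemma rV_norm_lt x (e : R) : 0 < e -> (forall j, `|x 0 j| < e) -> `|x| < e.
Proof.
move=> e0 xe; rewrite [ltLHS]/Num.Def.normr /= mx_normrE.
by apply: bigmax_lt => // -[i j] _ /=; rewrite (ord1 i).
Qed.

Lemma rV_continuousP (T : topologicalType) (c : T -> 'rV[R]_m) (t : T) :
  {for t, continuous c} <-> forall j, {for t, continuous (fun s => c s 0 j)}.
Proof.
split=> [cc j|cc].
  by apply: (@continuous_comp _ _ _ c (fun x => x 0 j)) => //; exact: coord_continuous.
apply/cvgrPdist_lt => e e0; near=> s.
apply: rV_norm_lt => // j; rewrite !mxE; move: j; near: s.
apply: filter_forall => j.
by have /cvgrPdist_lt := cc j; apply.
Unshelve. all: by end_near. Qed.

Lemma convex_norm_lt (s u w d : R) :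
  0 <= s <= 1 -> `|u| < d -> `|w| < d -> `|s * u + (1 - s) * w| < d.
Proof.
move=> /andP[s0 s1]; rewrite !ltr_norml => /andP[u1 u2] /andP[w1 w2].
by have [uw|/ltW uw] := leP u w; apply/andP; split; nra.
Qed.

Definition pd (g : 'rV[R]_m -> R) (j : 'I_m) x := 'D_(delta_mx 0 j) g x.

(* Coordinates are moved one at a time, with the mean value theorem on each
   axis-parallel segment. *)
Lemma strict_differentiability (g : 'rV[R]_m -> R) p :
  (forall j x, derivable g x (delta_mx 0 j)) ->
  (forall j, {for p, continuous (pd g j)}) ->
  forall e : R, 0 < e -> exists2 d : R, 0 < d &
    forall y z, `|y - p| < d -> `|z - p| < d ->
      `|g y - g z - \sum_j (y 0 j - z 0 j) * pd g j p| <= e * `|y - z|.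
Proof.
move=> dg cg e e0.
(* Each of the [m] coordinates may cost [e']; [m.+1] keeps [e'] positive when [m = 0]. *)
pose e' := e / m.+1%:R.
have e'0 : 0 < e' by rewrite divr_gt0.
have [d d0 hd] : exists2 d : R, 0 < d &
    forall x, `|x - p| < d -> forall j, `|pd g j x - pd g j p| <= e'.
  have : \forall x \near p, forall j, `|pd g j x - pd g j p| <= e'.
    near=> x => j; move: j; near: x; apply: filter_forall => j.
    have /cvgrPdist_le/(_ _ e'0) := cg j.
    by apply: filterS => x; rewrite distrC.
  move=> /nbhs_ballP[d /= d0 hd]; exists d => // x xp j.
  by apply: hd; rewrite -ball_normE /= distrC.
exists d => // y z yp zp.
pose q (k : nat) : 'rV[R]_m := \row_j (if (j < k)%N then y 0 j else z 0 j).
have qm : q m = y by apply/rowP => j; rewrite mxE ltn_ord.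
have q0 : q 0%N = z by apply/rowP => j; rewrite mxE ltn0.
have -> : g y - g z = \sum_(k < m) (g (q k.+1) - g (q k)).
  rewrite -(big_mkord xpredT (fun k => g (q k.+1) - g (q k))).
  by rewrite telescope_sumr // qm q0.
rewrite -sumrB; apply: le_trans (ler_norm_sum _ _ _) _.
have step (k : 'I_m) : `|g (q k.+1) - g (q k) - (y 0 k - z 0 k) * pd g k p| <=
    e' * `|y - z|.
  set a := y 0 k - z 0 k.
  have qS : q k.+1 = a *: delta_mx 0 k + q k.
    apply/rowP => j; rewrite !mxE eqxx /= ltnS leq_eqVlt.
    have [->|jk] := eqVneq j k.
      by rewrite eqxx ltnn /= mulr1 /a subrK.
    by rewrite -val_eqE in jk; rewrite (negbTE jk) /= mulr0 add0r.
  have [|s s01] := @MVT_line R _ g (q k) (a *: delta_mx 0 k).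
    move=> s; have := is_derive_scale a (derivableP (dg k (s *: (a *: delta_mx 0 k) + q k))).
    by case.
  rewrite -qS => ->.
  set xi := s *: _ + _.
  have [_ ->] := is_derive_scale a (derivableP (dg k xi)).
  rewrite -mulrBr normrM mulrC ler_pM //.
    (* A ball of the sup norm is a box: each coordinate of [xi] is that of [y], that of [z], or a
       convex combination of the two. *)
    apply: hd; apply: rV_norm_lt => // j; rewrite !mxE eqxx /=.
    have yj : `|y 0 j - p 0 j| < d.
      by apply: le_lt_trans yp; have := rV_coord_le (y - p) j; rewrite !mxE.
    have zj : `|z 0 j - p 0 j| < d.
      by apply: le_lt_trans zp; have := rV_coord_le (z - p) j; rewrite !mxE.
    have [jk|jk] := eqVneq j k; last by rewrite /= !mulr0 add0r; case: ifP.
    rewrite !jk in yj zj *; rewrite ltnn mulr1 /a.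
    have -> : s * (y 0 k - z 0 k) + z 0 k - p 0 k =
        s * (y 0 k - p 0 k) + (1 - s) * (z 0 k - p 0 k) by ring.
    exact: convex_norm_lt.
  by have := rV_coord_le (y - z) k; rewrite !mxE.
apply: le_trans (ler_sum _ (fun k _ => step k)) _.
rewrite sumr_const card_ord -mulr_natr mulrAC ler_wpM2r // mulrAC.
by rewrite ler_pdivrMr ?ltr0n // ler_wpM2l ?(ltW e0) // ler_nat.
Unshelve. all: by end_near. Qed.

(** The remainder of strict differentiability at [c t], divided by [h], is a small constant times a
    difference quotient of [c], and these quotients stay bounded as [h] tends to 0. *)
Lemma is_derive_comp_curve (g : 'rV[R]_m -> R) (c : R -> 'rV[R]_m) (t : R)
    (c' : 'I_m -> R) :
  (forall j x, derivable g x (delta_mx 0 j)) ->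
  (forall j, {for c t, continuous (pd g j)}) ->
  (forall j, is_derive t 1 (fun s => c s 0 j) (c' j)) ->
  is_derive t 1 (g \o c) (\sum_j c' j * pd g j (c t)).
Proof.
move=> dg cg dc; apply/is_derive_cvgP.
pose q (j : 'I_m) (h : R) := h^-1 * (c (h + t) 0 j - c t 0 j).
have qc j : q j h @[h --> 0^'] --> c' j.
  have /is_derive_cvgP := dc j; apply: cvg_trans.
  by apply: near_eq_cvg; near=> h; rewrite /q /= [h%:A]mulr1.
pose D (h : R) := \sum_j q j h * pd g j (c t).
have Dc : D h @[h --> 0^'] --> \sum_j c' j * pd g j (c t).
  by apply: cvg_big => [|j _]; [exact: add_continuous|apply: cvgMr_tmp; exact: qc].
have ct : {for t, continuous c}.
  apply/rV_continuousP => j; apply/differentiable_continuous/derivable1_diffP.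
  by case: (dc j).
(* Eventually bounds the sup norm of the difference quotient of [c]; the last 1 keeps [C] positive
   when [m = 0]. *)
pose C : R := \sum_j (`|c' j| + 1) + 1.
have C0 : 0 < C.
  by rewrite ltr_wpDl // sumr_ge0 // => j _; rewrite addr_ge0.
rewrite -[X in _ --> X]add0r.
have -> : (fun h : R => h^-1 *: (((g \o c) \o shift t) h%:A - (g \o c) t)) =
    (fun h => (h^-1 * (g (c (h + t)) - g (c t)) - D h) + D h).
  by apply/funext => h; rewrite subrK /= [h%:A]mulr1.
apply: cvgD => //.
apply/cvgr0Pnorm_le => e e0.
have [d d0 hd] := strict_differentiability dg cg (divr_gt0 e0 C0).
near=> h.
have h0 : h != 0 by near: h; exact: nbhs_dnbhs_neq.
have ch : `|c (h + t) - c t| < d.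
  near: h; apply: nbhs_dnbhs.
  have /cvgrPdist_lt/(_ _ d0) := ct.
  move=> /nbhs0P; apply: filterS => h.
  by rewrite [t + h]addrC distrC.
have ctt : `|c t - c t| < d by rewrite subrr normr0.
have H := hd _ _ ch ctt.
have -> : h^-1 * (g (c (h + t)) - g (c t)) - D h =
   h^-1 * (g (c (h + t)) - g (c t) - \sum_j (c (h + t) 0 j - c t 0 j) * pd g j (c t)).
  rewrite [RHS]mulrBr mulr_sumr; congr (_ - _).
  by apply: eq_bigr => j _; rewrite /q mulrA.
rewrite normrM.
apply: le_trans (ler_wpM2l (normr_ge0 _) H) _.
rewrite mulrCA -normrZ -ler_pdivlMl ?divr_gt0 // invf_div divfK ?gt_eqF //.
apply: rV_norm_le => [|j]; first exact: ltW.
rewrite !mxE.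
have : `|q j h| <= `|c' j| + 1.
  move: j; near: h; apply: filter_forall => j.
  have /cvgrPdist_le/(_ _ ltr01) := qc j; apply: filterS => k kj.
  by rewrite -(subKr (c' j) (q j k)) (le_trans (ler_normB _ _)) // lerD2l.
move=> /le_trans; apply; rewrite /C (bigD1 j) //= -addrA lerDl addr_ge0 //.
by rewrite sumr_ge0 // => i _; rewrite addr_ge0.
Unshelve. all: by end_near. Qed.

End RowVectors.

(** * Algebra of smooth functions *)

(* A record rather than a definition, so that unification never unfolds it. *)
Record smooth {R : realType} {V W : normedModType R} (f : V -> W) : Prop :=
  Smooth { smooth_setT : smooth_on setT f }.

Section SmoothClasses.
Context {R : realType} {V W : normedModType R}.
Implicit Types (f : V -> W) (x v : V).

Lemma smooth_continuous f : smooth f -> continuous f.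
Proof. by move=> [sf] x; have [] := sf [::] x I. Qed.

Lemma smooth_derivable f x v : smooth f -> derivable f x v.
Proof. by move=> [sf]; have [_] := sf [::] x I; apply. Qed.

Lemma smooth_is_derive f x v : smooth f -> is_derive x v f ('D_v f x).
Proof. by move=> sf; apply: derivableP; exact: smooth_derivable. Qed.

Lemma smooth_derive f v : smooth f -> smooth (fun x => 'D_v f x).
Proof.
move=> [sf]; split=> s x _.
by have := sf (rcons s v) x I; rewrite /iter_derive foldr_rcons.
Qed.

Lemma smooth_smooth_on f (O : set V) : smooth f -> smooth_on O f.
Proof. by move=> [sf] s x _; exact: sf. Qed.

(* Coinduction principle: smoothness is the largest class of continuous
   functions stable under directional derivatives. *)
Lemma smooth_class (C : set (V -> W)) :
  (forall f, C f -> continuous f) ->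
  (forall f x v, C f -> derivable f x v) ->
  (forall f v, C f -> C (fun x => 'D_v f x)) ->
  forall f, C f -> smooth f.
Proof.
move=> Cc Cd CD f Cf; split=> s x _.
have Cs : C (iter_derive s f) by elim: s => //= v s; exact: CD.
by split; [exact: Cc|move=> v; exact: Cd].
Qed.

End SmoothClasses.

(** * Coinduction up to sums and products *)

Section SmoothAlgebra.
Context {R : realType} {V : normedModType R}.
Implicit Types (f g : V -> R) (S : set (V -> R)).

(** The Leibniz rule turns a product into a sum of products, so a class to which [smooth_class]
    applies has to be a whole algebra: the one generated by the functions under study. *)
Inductive generated S : (V -> R) -> Prop :=
| Gen_base f of S f : generated S f
| Gen_cst (a : R) : generated S (fun=> a)
| Gen_add f g of generated S f & generated S g : generated S (fun x => f x + g x)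
| Gen_mul f g of generated S f & generated S g : generated S (fun x => f x * g x).

Lemma generated_sum S (I : Type) (r : seq I) (F : I -> V -> R) :
  (forall i, generated S (F i)) -> generated S (fun x => \sum_(i <- r) F i x).
Proof.
move=> SF; elim: r => [|i r ih].
  have -> : (fun x => \sum_(i <- [::]) F i x) = fun=> 0.
    by apply/funext => x; rewrite big_nil.
  exact: Gen_cst.
have -> : (fun x => \sum_(j <- i :: r) F j x) =
    fun x => F i x + \sum_(j <- r) F j x.
  by apply/funext => x; rewrite big_cons.
exact: Gen_add.
Qed.

(** The derivative of a generator may be any element of the algebra. Thus [1 / f] can be adjoined to
    the smooth functions, its derivative being [- (1 / f) ^ 2] times a smooth function; so can the
    composites with a fixed map, by the chain rule. *)
Lemma generated_smooth S :
  (forall f, S f -> continuous f) ->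
  (forall f (v : V), S f ->
     exists2 f', generated S f' & forall x, is_derive x v f (f' x)) ->
  forall f, generated S f -> smooth f.
Proof.
move=> Sc Sd.
have D f : generated S f -> forall v,
    exists2 f', generated S f' & forall x, is_derive x v f (f' x).
  elim=> {f} [f Sf v|a v|f g gf ihf gg ihg v|f g gf ihf gg ihg v].
  - exact: Sd.
  - by exists (fun=> 0) => [|x]; [exact: Gen_cst|exact: is_derive_cst].
  - have [[f' gf' df] [g' gg' dg]] := (ihf v, ihg v).
    exists (fun x => f' x + g' x) => [|x]; first exact: Gen_add.
    exact: is_deriveD.
  - have [[f' gf' df] [g' gg' dg]] := (ihf v, ihg v).
    exists (fun x => f x * g' x + g x * f' x) => [|x].
      by apply: Gen_add; apply: Gen_mul.
    exact: is_deriveM.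
apply: smooth_class => [f|f x v|f v].
- elim=> {f} [f /Sc//|a|f g _ cf _ cg|f g _ cf _ cg].
  + exact: cst_continuous.
  + by move=> x; apply: continuousD; [exact: cf|exact: cg].
  + by move=> x; apply: continuousM; [exact: cf|exact: cg].
- by move=> /D/(_ v)[f' _ /(_ x)[]].
- move=> /D/(_ v)[f' gf' df].
  by have -> : (fun x => 'D_v f x) = f' by apply/funext => x; case: (df x).
Qed.

Lemma smooth_generated f :
  generated [set g | smooth g] f -> smooth f.
Proof.
apply: generated_smooth => [g /smooth_continuous//|g v sg].
exists (fun x => 'D_v g x); first by apply: Gen_base; exact: smooth_derive.
by move=> x; apply: derivableP; exact: smooth_derivable.
Qed.

Lemma smooth_cst (a : R) : smooth (fun _ : V => a).
Proof. by apply: smooth_generated; exact: Gen_cst. Qed.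

Lemma smoothD f g : smooth f -> smooth g ->
  smooth (fun x => f x + g x).
Proof. by move=> sf sg; apply: smooth_generated; apply: Gen_add; apply: Gen_base. Qed.

Lemma smoothM f g : smooth f -> smooth g ->
  smooth (fun x => f x * g x).
Proof. by move=> sf sg; apply: smooth_generated; apply: Gen_mul; apply: Gen_base. Qed.

Lemma smoothN f : smooth f -> smooth (fun x => - f x).
Proof.
move=> sf; have -> : (fun x => - f x) = fun x => -1 * f x.
  by apply/funext => x; rewrite mulN1r.
by apply: smoothM => //; exact: smooth_cst.
Qed.

Lemma smoothB f g : smooth f -> smooth g ->
  smooth (fun x => f x - g x).
Proof. by move=> sf sg; apply: smoothD => //; exact: smoothN. Qed.

Lemma smooth_sum (I : Type) (r : seq I) (F : I -> V -> R) :
  (forall i, smooth (F i)) ->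
  smooth (fun x => \sum_(i <- r) F i x).
Proof.
by move=> sF; apply: smooth_generated; apply: generated_sum => i; exact: Gen_base.
Qed.

Lemma smoothX f n : smooth f -> smooth (fun x => f x ^+ n).
Proof.
move=> sf; elim: n => [|n ih]; first exact: smooth_cst.
have -> : (fun x => f x ^+ n.+1) = fun x => f x * f x ^+ n.
  by apply/funext => x; rewrite exprS.
exact: smoothM.
Qed.

Lemma smoothV f : (forall x, f x != 0) -> smooth f ->
  smooth (fun x => (f x)^-1).
Proof.
move=> f0 sf.
pose S := [set g | smooth g] `|` [set fun x => (f x)^-1].
have SV : generated S (fun x => (f x)^-1) by apply: Gen_base; right.
apply: (@generated_smooth S) => // [g [/smooth_continuous //|->] x|g v [sg|->]].
- apply: continuousV; first exact: f0.
  exact: smooth_continuous.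
- exists (fun x => 'D_v g x); first by apply: Gen_base; left; exact: smooth_derive.
  by move=> x; exact: smooth_is_derive.
- exists (fun x => (-1 * ((f x)^-1 * (f x)^-1)) * 'D_v f x).
    apply: Gen_mul; last by apply: Gen_base; left; exact: smooth_derive.
    by apply: Gen_mul; [exact: Gen_cst|exact: Gen_mul].
  move=> x; have dx := @smooth_derivable _ _ _ f x v sf.
  split; first exact: derivableV.
  by rewrite deriveV // mulN1r -invfM -expr2.
Qed.

End SmoothAlgebra.

Section SmoothComposition.
Context {R : realType}.
Implicit Types (V W : normedModType R).

Lemma is_derive_comp V m (g : 'rV[R]_m -> R) (c : V -> 'rV[R]_m) (x v : V)
    (c' : 'I_m -> R) :
  smooth g ->
  (forall j, is_derive x v (fun y => c y 0 j) (c' j)) ->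
  is_derive x v (g \o c) (\sum_j c' j * pd g j (c x)).
Proof.
move=> sg dc; apply: is_derive_line0.
have := @is_derive_comp_curve R m g (fun s => c (s *: v + x)) 0 c'.
rewrite scale0r add0r; apply.
- by move=> j y; exact: smooth_derivable.
- by move=> j; apply: smooth_continuous; exact: smooth_derive.
- move=> j; have := @is_derive_line R V R (fun y => c y 0 j) x v 0 (c' j).
  by rewrite scale0r add0r; apply.
Qed.

Lemma smooth_comp V m (g : 'rV[R]_m -> R) (c : V -> 'rV[R]_m) :
  smooth g -> (forall j, smooth (fun y => c y 0 j)) ->
  smooth (g \o c).
Proof.
move=> sg sc.
pose S := [set h : V -> R | smooth h \/
  exists2 g' : 'rV[R]_m -> R, smooth g' & h = g' \o c].
have Sg g' : smooth g' -> generated S (g' \o c).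
  by move=> sg'; apply: Gen_base; right; exists g'.
have cc : continuous c.
  by move=> x; apply/rV_continuousP => j; exact: smooth_continuous.
apply: (@generated_smooth _ _ S) => [h|h v|]; last exact: Sg.
- case=> [/smooth_continuous //|[g' sg' ->]] x.
  by apply: continuous_comp; [exact: cc|exact: smooth_continuous].
- case=> [sh|[g' sg' ->]].
    exists (fun x => 'D_v h x); first by apply: Gen_base; left; exact: smooth_derive.
    by move=> x; exact: smooth_is_derive.
  exists (fun x => \sum_j 'D_v (fun y => c y 0 j) x * pd g' j (c x)) => [|x].
    apply: generated_sum => j; apply: Gen_mul.
      by apply: Gen_base; left; exact: smooth_derive.
    exact: (Sg (pd g' j) (smooth_derive _ sg')).
  apply: is_derive_comp => // j; apply: derivableP; exact: smooth_derivable.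
Qed.

Lemma smooth_comp1 V (g : R -> R) (c : V -> R) :
  smooth g -> smooth c -> smooth (g \o c).
Proof.
move=> sg sc.
pose S := [set h : V -> R | smooth h \/
  exists2 g' : R -> R, smooth g' & h = g' \o c].
have Sg g' : smooth g' -> generated S (g' \o c).
  by move=> sg'; apply: Gen_base; right; exists g'.
apply: (@generated_smooth _ _ S) => [h|h v|]; last exact: Sg.
- case=> [/smooth_continuous //|[g' sg' ->]] x.
  by apply: continuous_comp; exact: smooth_continuous.
- case=> [sh|[g' sg' ->]].
    exists (fun x => 'D_v h x); first by apply: Gen_base; left; exact: smooth_derive.
    by move=> x; exact: smooth_is_derive.
  exists (fun x => 'D_1 g' (c x) * 'D_v c x) => [|x].
    apply: Gen_mul; first exact: (Sg (fun y => 'D_1 g' y) (smooth_derive _ sg')).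
    by apply: Gen_base; left; exact: smooth_derive.
  apply: is_derive_line0; apply: is_derive1_comp.
    by rewrite scale0r add0r; exact: smooth_is_derive.
  by apply: is_derive_line; rewrite scale0r add0r; exact: smooth_is_derive.
Qed.

Lemma smooth_rV V m (f : V -> 'rV[R]_m) :
  (forall j, smooth (fun x => f x 0 j)) -> smooth f.
Proof.
move: f; apply: smooth_class => [f sf|f x v sf|f v sf].
- by move=> x; apply/rV_continuousP => j; exact: smooth_continuous.
- by apply/derivable_mxP => i j; rewrite (ord1 i); exact: smooth_derivable.
- move=> j.
  have -> : (fun x => 'D_v f x 0 j) = fun x => 'D_v (fun y => f y 0 j) x.
    apply/funext => x; rewrite derive_mx ?mxE //.
    by apply/derivable_mxP => i k; rewrite (ord1 i); exact: smooth_derivable.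
  exact: smooth_derive.
Qed.

Lemma smooth_linear V W (f : V -> W) :
  continuous f -> (forall (a : R) u v, f (a *: u + v) = a *: f u + f v) -> smooth f.
Proof.
move=> cf lf.
have df x v : is_derive x v f (f v).
  apply/is_derive_cvgP; apply: (@cvg_trans _ (cst (f v) @ (0 : R)^')); last exact: cvg_cst.
  apply: near_eq_cvg; near=> h.
  rewrite /= lf addrK scalerA mulVf ?scale1r //.
  by near: h; exact: nbhs_dnbhs_neq.
pose C := [set h : V -> W | h = f \/ exists w, h = fun=> w].
apply: (@smooth_class _ _ _ C) => [h|h x v|h v|]; last by left.
- by case=> [->//|[w ->]]; exact: cst_continuous.
- by case=> [->|[w ->]]; [case: (df x v)|exact: derivable_cst].
- case=> [->|[w ->]]; right.
    by exists (f v); apply/funext => x; case: (df x v).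
  by exists 0; apply/funext => x; rewrite derive_cst.
Unshelve. all: by end_near. Qed.

Lemma smooth_coord m (j : 'I_m) : smooth (fun x : 'rV[R]_m => x 0 j).
Proof. by apply: smooth_linear => [|a u v]; [exact: coord_continuous|rewrite !mxE]. Qed.

Lemma smooth_snd V W : smooth (fun p : V * W => p.2).
Proof. by apply: smooth_linear => // p; exact: cvg_snd. Qed.

Lemma smooth_pair V W1 W2 (f : V -> W1) (g : V -> W2) :
  smooth f -> smooth g -> smooth (fun x => (f x, g x)).
Proof.
have D (f' : V -> W1) (g' : V -> W2) x v : smooth f' -> smooth g' ->
    is_derive x v (fun x => (f' x, g' x)) ('D_v f' x, 'D_v g' x).
  move=> sf sg; apply/is_derive_cvgP.
  have /is_derive_cvgP cf := smooth_is_derive x v sf.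
  have /is_derive_cvgP cg := smooth_is_derive x v sg.
  exact: (cvg_pair cf cg).
move=> sf sg.
pose C := [set h : V -> W1 * W2 | exists f' g',
  [/\ smooth f', smooth g' & h = fun x => (f' x, g' x)]].
apply: (@smooth_class _ _ _ C) => [h|h x v|h v|]; last by exists f, g.
- move=> [f' [g' [sf' sg' ->]]] x.
  have cf : f' y @[y --> x] --> f' x by exact: smooth_continuous.
  have cg : g' y @[y --> x] --> g' x by exact: smooth_continuous.
  exact: (cvg_pair cf cg).
- by move=> [f' [g' [sf' sg' ->]]]; case: (D f' g' x v sf' sg').
- move=> [f' [g' [sf' sg' ->]]]; exists (fun x => 'D_v f' x), (fun x => 'D_v g' x).
  split; [exact: smooth_derive..|].
  by apply/funext => x; case: (D f' g' x v sf' sg').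
Qed.

End SmoothComposition.

(** * Differential inequalities on the unit interval *)

Section UnitInterval.
Context {R : realType}.
Implicit Types (t : R).

Lemma is_derive_mull (a t : R) : is_derive t 1 (fun s : R => a * s) a.
Proof.
have -> : (fun s : R => a * s) = a \*: (@id R) by [].
by apply: is_derive_eq; rewrite [LHS]mulr1.
Qed.

Lemma is_derive_sqr (V : normedModType R) (f : V -> R) (x v : V) (df : R) :
  is_derive x v f df -> is_derive x v (fun y => f y ^+ 2) (2 * f x * df).
Proof.
move=> H; have -> : (fun y => f y ^+ 2) = f * f.
  by apply/funext => y; rewrite expr2.
by apply: is_derive_eq; rewrite /GRing.scale /=; ring.
Qed.

Lemma nondecreasing_from0 (f f' : R -> R) :
  (forall t, 0 <= t <= 1 -> is_derive t 1 f (f' t)) ->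
  (forall t, 0 <= t <= 1 -> 0 <= f' t) ->
  forall t, 0 <= t <= 1 -> f 0 <= f t.
Proof.
move=> df f'0 t /andP[t0 t1].
have sub s : s \in `[0, t] -> 0 <= s <= 1.
  by rewrite in_itv /= => /andP[-> /le_trans ->].
have [||c ct E] := @MVT_segment R f f' 0 t t0.
- move=> s st; apply: df; apply: sub; move: st; rewrite !in_itv /=.
  by move=> /andP[/ltW -> /ltW ->].
- by apply: derivable_within_continuous => s /sub/df; case.
by rewrite -subr_ge0 E mulr_ge0 ?subr0 // f'0 // sub.
Qed.

(** Stands in for bounding an integral by the integral of a bound. With [w = 0] it says that a
    function with zero derivative and zero initial value vanishes, which yields first integrals. *)
Lemma norm_le_of_derive (u u' w w' : R -> R) :
  (forall t, 0 <= t <= 1 -> is_derive t 1 u (u' t)) ->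
  (forall t, 0 <= t <= 1 -> is_derive t 1 w (w' t)) ->
  (forall t, 0 <= t <= 1 -> `|u' t| <= w' t) ->
  `|u 0| <= w 0 ->
  forall t, 0 <= t <= 1 -> `|u t| <= w t.
Proof.
move=> du dw le0; rewrite ler_norml => /andP[u0 u1] t t01.
have a := @nondecreasing_from0 (w - u) (fun t => w' t - u' t)
  (fun s s01 => is_deriveB (dw s s01) (du s s01)) _ t t01.
have b := @nondecreasing_from0 (w + u) (fun t => w' t + u' t)
  (fun s s01 => is_deriveD (dw s s01) (du s s01)) _ t t01.
have {}a : w 0 - u 0 <= w t - u t.
  by apply: a => s /le0; rewrite ler_norml subr_ge0 => /andP[].
have {}b : w 0 + u 0 <= w t + u t.
  by apply: b => s /le0; rewrite ler_norml lerNl -subr_ge0 opprK => /andP[].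
by rewrite ler_norml; apply/andP; split; lra.
Qed.

Lemma primitive_exists (h : R -> R) : continuous h ->
  exists2 H : R -> R, H 0 = 0 & forall t, 0 <= t <= 1 -> is_derive t 1 H (h t).
Proof.
move=> ch.
(* Integrating from -1 makes every point of the unit interval, 0 included, an interior point, so the
   derivatives are two-sided. *)
pose G (x : R) : R := (\int[lebesgue_measure]_(t in [set` `[-1, x]]) (h t))%R.
have dG t : 0 <= t <= 1 -> is_derive t 1 G (h t).
  move=> /andP[t0 t1].
  have [||||d <-] := @continuous_FTC1_closed R h (-1) t (t + 1).
  - by rewrite ltrDl.
  - apply: continuous_compact_integrable; first exact: segment_compact.
    by apply: continuous_subspaceT.
  - by apply: lt_le_trans t0; rewrite oppr_lt0.
  - exact: ch.
  by rewrite derive1E; exact: derivableP.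
exists (fun x => G x - G 0) => [|t t01]; first by rewrite subrr.
have := is_deriveB (dG t t01) (is_derive_cst (G 0) t 1).
by rewrite subr0.
Qed.

(** Precomposition with it turns a curve controlled only on the unit interval into one continuous on
    the whole line, as the Picard iteration requires. *)
Definition clamp t := Num.max 0 (Num.min t 1).

Lemma clamp_itv t : 0 <= clamp t <= 1.
Proof. by rewrite /clamp le_max lexx /= ge_max ler01 ge_min lexx orbT. Qed.

Lemma clamp_id t : 0 <= t <= 1 -> clamp t = t.
Proof. by move=> /andP[t0 t1]; rewrite /clamp (min_idPl t1) (max_idPr t0). Qed.

Lemma clamp_continuous : continuous clamp.
Proof.
move=> t; apply: (@continuous_max R R (cst 0) (fun t => Num.min t 1)).
  exact: cst_continuous.
by apply: (@continuous_min R R id (cst 1)); [exact: cvg_id|exact: cst_continuous].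
Qed.

Lemma continuous_bounded_unit_itv (f : R -> R) : continuous f ->
  exists2 C, 0 <= C & forall t, 0 <= t <= 1 -> `|f t| <= C.
Proof.
move=> cf.
have [|c c01 mc] := @EVT_max R (fun t => `|f t|) 0 1 ler01.
  apply: continuous_subspaceT => t; apply: continuous_comp; first exact: cf.
  exact: norm_continuous.
by exists `|f c| => // t t01; apply: mc; rewrite in_itv.
Qed.

Lemma geometric_small (B e : R) : 0 < e -> exists k, B * 2^-1 ^+ k < e.
Proof.
move=> e0.
have /cvgrPdist_lt/(_ _ (divr_gt0 e0 (ltr_wpDl (normr_ge0 B) ltr01))) :
  2^-1 ^+ k @[k --> \oo] --> (0 : R).
  by apply: cvg_expr; rewrite ger0_norm ?invr_ge0 // invf_lt1 ?ltr1n.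
move=> [k _ /(_ k (leqnn k)) /=]; rewrite sub0r normrN ger0_norm ?exprn_ge0 ?invr_ge0 // => H.
exists k; have B1 : B <= `|B| + 1 by rewrite (le_trans (ler_norm B)) // lerDl.
apply: le_lt_trans (ler_wpM2r _ B1) _; first by rewrite exprn_ge0 ?invr_ge0.
by rewrite mulrC -ltr_pdivlMr // ltr_wpDl.
Qed.

End UnitInterval.

Section Gronwall.
Context {R : realType} {m : nat}.

(** Stated by coordinates so that the scalar lemmas apply. The derivatives are two-sided even at 0
    and 1. *)
Definition has_velocity (c c' : R -> 'rV[R]_m) :=
  forall t : R, 0 <= t <= 1 ->
    forall j, is_derive t 1 (fun s => c s 0 j) (c' t 0 j).

(** [K] is chosen before the curve and the error [e], which makes later estimates uniform in the
    initial condition. As the sup norm is not differentiable, the argument runs with the sum of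
    squares [u], which lies between [|c| ^ 2] and [m * |c| ^ 2]. *)
Lemma gronwall (L : R) : 0 <= L -> exists2 K : R, 0 <= K &
  forall (c c' : R -> 'rV[R]_m) (e : R), 0 <= e -> has_velocity c c' ->
    (forall t, 0 <= t <= 1 -> `|c' t| <= L * `|c t| + e) ->
    forall t, 0 <= t <= 1 -> `|c t| <= K * (`|c 0| + e).
Proof.
move=> L0.
(* Each of the [m] terms of [u'] is at most [2 * |c| * (L * |c| + e)], and
   [2 * |c| * e <= |c| ^ 2 + e ^ 2]; hence [u' <= A * u + m * e ^ 2]. *)
pose A : R := m%:R * (2 * L + 1).
have A0 : 0 <= A by rewrite mulr_ge0 // addr_ge0 // mulr_ge0.
(* The final bound concerns [|c| ^ 2] and has the factor [x = expR A * m]; the inequality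
   [x <= (x + 1) ^ 2] spares a square root. *)
exists (expR A * m%:R + 1) => [|c c' e e0 dc cb t t01].
  by rewrite addr_ge0 // mulr_ge0 // expR_ge0.
pose u (t : R) := \sum_j c t 0 j ^+ 2.
have cu s : `|c s| ^+ 2 <= u s.
  have u0 : 0 <= u s by apply: sumr_ge0 => j _; exact: sqr_ge0.
  rewrite -[u s]sqr_sqrtr // ler_sqr ?nnegrE ?sqrtr_ge0 //.
  apply: rV_norm_le => [|j]; first exact: sqrtr_ge0.
  rewrite -ler_sqr ?nnegrE ?sqrtr_ge0 // sqr_sqrtr // real_normK ?num_real //.
  by rewrite /u (bigD1 j) //= lerDl sumr_ge0 // => i _; exact: sqr_ge0.
have uc s : u s <= m%:R * `|c s| ^+ 2.
  rewrite mulr_natl -[m in _ *+ m]card_ord -sumr_const; apply: ler_sum => j _.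
  by rewrite -real_normK ?num_real // ler_sqr ?nnegrE // rV_coord_le.
pose u' (t : R) := \sum_j 2 * c t 0 j * c' t 0 j.
have du (s : R) : 0 <= s <= 1 -> is_derive s 1 u (u' s).
  move=> s01.
  have -> : u = \sum_j (fun s => c s 0 j ^+ 2).
    by apply/funext => x; rewrite fct_sumE.
  apply: is_derive_sum => j.
  have H := dc s s01 j.
  exact: is_derive_sqr.
have u'u (s : R) : 0 <= s <= 1 -> u' s <= A * u s + m%:R * e ^+ 2.
  move=> s01; apply: (@le_trans _ _ (m%:R * (2 * `|c s| * (L * `|c s| + e)))).
    rewrite [leRHS]mulr_natl -[m in _ *+ m]card_ord -sumr_const; apply: ler_sum => j _.
    apply: le_trans (ler_norm _) _; rewrite !normrM normr_nat.
    rewrite ler_pM ?mulr_ge0 // ?ler_wpM2l ?rV_coord_le //.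
    by apply: le_trans (cb s s01); exact: rV_coord_le.
  rewrite /A -!mulrA -mulrDr ler_wpM2l //.
  have : 0 <= (2 * L + 1) * (u s - `|c s| ^+ 2).
    by apply: mulr_ge0; [lra|rewrite subr_ge0].
  have := sqr_ge0 (`|c s| - e); set x := `|c s|; lra.
(* With the integrating factor [expR (- A * s)], which is at most 1, the inequality
   [u' - A * u <= m * e ^ 2] says that [G] is nondecreasing. *)
pose G (s : R) := m%:R * e ^+ 2 * s - expR (- A * s) * u s.
have dG (s : R) : 0 <= s <= 1 ->
    is_derive s 1 G (m%:R * e ^+ 2 - expR (- A * s) * (u' s - A * u s)).
  move=> s01; have dus := du s s01.
  have dE : is_derive s 1 (fun s => expR (- A * s)) (expR (- A * s) * - A).
    exact: is_derive1_comp (is_derive_expR _) (is_derive_mull _ _).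
  apply: is_derive_eq.
  by rewrite /GRing.scale /=; ring.
have := @nondecreasing_from0 _ G _ dG _ t t01.
rewrite /G !mulr0 sub0r expR0 mul1r => H.
have {}H : expR (- A * t) * u t <= u 0 + m%:R * e ^+ 2.
  have : - u 0 <= m%:R * e ^+ 2 * t - expR (- A * t) * u t.
    apply: H => s s01; rewrite subr_ge0.
    have E1 : expR (- A * s) <= 1.
      by rewrite -expR0 ler_expR mulNr oppr_le0 mulr_ge0 //; case/andP: s01.
    have M0 : 0 <= m%:R * e ^+ 2 by rewrite mulr_ge0 // sqr_ge0.
    apply: le_trans (ler_piMl M0 E1); rewrite ler_wpM2l ?expR_ge0 // lerBlDl.
    exact: u'u.
  have : 0 <= m%:R * e ^+ 2 by rewrite mulr_ge0 // sqr_ge0.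
  move: t01 => /andP[]; set M := m%:R * _; nra.
have u1 : u t <= expR A * (m%:R * (`|c 0| + e) ^+ 2).
  have -> : u t = expR (A * t) * (expR (- A * t) * u t).
    by rewrite mulrA -expRD mulNr subrr expR0 mul1r.
  apply: ler_pM => //.
  - by rewrite mulr_ge0 ?expR_ge0 // sumr_ge0 // => j _; exact: sqr_ge0.
  - by rewrite ler_expR ler_piMr //; case/andP: t01.
  apply: le_trans H _; have := uc 0.
  have : 0 <= m%:R * (`|c 0| * e) by rewrite !mulr_ge0.
  set M := m%:R; set x := `|c 0|; lra.
rewrite -ler_sqr ?nnegrE ?mulr_ge0 ?addr_ge0 ?mulr_ge0 ?expR_ge0 //.
apply: le_trans (cu t) _; apply: le_trans u1 _.
rewrite exprMn mulrA ler_wpM2r ?sqr_ge0 //.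
have : 0 <= expR A * m%:R by rewrite mulr_ge0 // expR_ge0.
set x := expR A * _; nra.
Qed.

End Gronwall.

(** * Existence of solutions *)

Section Picard.
Context {R : realType} {m : nat}.
Variables (F : R -> 'rV[R]_m -> 'rV[R]_m) (L : R) (x0 : 'rV[R]_m).
Hypothesis F_continuous : forall c : R -> 'rV[R]_m,
  continuous c -> continuous (fun s => F s (c s)).
Hypothesis L0 : 0 <= L.
Hypothesis F_lipschitz : forall (s : R) x y,
  0 <= s <= 1 -> `|F s x - F s y| <= L * `|x - y|.

Lemma rV_primitive_exists (c : R -> 'rV[R]_m) : continuous c ->
  exists2 H : R -> 'rV[R]_m, H 0 = x0 & has_velocity H c.
Proof.
move=> cc.
have P (j : 'I_m) : {H : R -> R | H 0 = 0 & forall t : R, 0 <= t <= 1 -> is_derive t 1 H (c t 0 j)}.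
  have cj : continuous (fun s => c s 0 j) by move=> s; apply: (rV_continuousP c s).1; exact: cc.
  by apply: cid2; exact: primitive_exists.
exists (fun t => \row_j (x0 0 j + sval (P j) t)) => [|t t01 j].
  by apply/rowP => j; rewrite mxE; case: (P j) => H /= ->; rewrite addr0.
have -> : (fun s => (\row_j (x0 0 j + sval (P j) s)) 0 j) =
    (cst (x0 0 j)) + (sval (P j)).
  by apply/funext => s; rewrite mxE.
have dP : is_derive t 1 (sval (P j)) (c t 0 j) by case: (P j) => H /= _; exact.
rewrite -[c t 0 j]add0r.
exact: (is_deriveD (is_derive_cst _ _ _) dP).
Qed.

Lemma velocity_continuous (c c' : R -> 'rV[R]_m) (t : R) : has_velocity c c' ->
  0 <= t <= 1 -> {for t, continuous c}.
Proof.
move=> dc t01; apply/rV_continuousP => j.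
by apply/differentiable_continuous/derivable1_diffP; case: (dc t t01 j).
Qed.

Lemma velocity_clamp_continuous (c c' : R -> 'rV[R]_m) : has_velocity c c' ->
  continuous (c \o clamp).
Proof.
move=> dc t; apply: continuous_comp; first exact: clamp_continuous.
by apply: (velocity_continuous dc); exact: clamp_itv.
Qed.

(* Picard iteration. The weight [e^(2Lt)] makes the integral operator a
   contraction of ratio 1/2 on the whole interval. *)
Lemma ode_exists : exists2 c : R -> 'rV[R]_m,
  c 0 = x0 & has_velocity c (fun t => F t (c t)).
Proof.
(* The integral operator as a total function: the value [c] at a discontinuous curve is a default
   that the iteration never meets. *)
pose T (c : R -> 'rV[R]_m) : R -> 'rV[R]_m := if pselect (continuous c) is left cc
  then s2val (cid2 (rV_primitive_exists (F_continuous cc))) else c.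
have TP c : continuous c -> T c 0 = x0 /\ has_velocity (T c) (fun t => F t (c t)).
  by move=> cc; rewrite /T; case: pselect => // cc'; case: cid2.
pose p := fix p k : R -> 'rV[R]_m := if k is k'.+1 then T (p k') \o clamp else cst x0.
have pc k : continuous (p k).
  elim: k => [|k ih]; first exact: cst_continuous.
  exact: (velocity_clamp_continuous (TP _ ih).2).
have pS k t : 0 <= t <= 1 -> p k.+1 t = T (p k) t by move=> t01; rewrite /= clamp_id.
have pclamp k t : p k (clamp t) = p k t.
  by case: k => //= k; rewrite (clamp_id (clamp_itv t)).
(* The contraction estimate with its weight left free: an exponential bounds the successive
   iterates, a linear function the defect of the limit. *)
have TD (c1 c2 : R -> 'rV[R]_m) (b b' : R -> R) :
    continuous c1 -> continuous c2 -> 0 <= b 0 ->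
    (forall t : R, 0 <= t <= 1 -> is_derive t 1 b (b' t)) ->
    (forall t : R, 0 <= t <= 1 -> L * `|c1 t - c2 t| <= b' t) ->
    forall t, 0 <= t <= 1 -> `|T c1 t - T c2 t| <= b t.
  move=> cc1 cc2 b0 db bb t t01.
  have [T10 dT1] := TP _ cc1; have [T20 dT2] := TP _ cc2.
  have B j : `|(T c1 t - T c2 t) 0 j| <= b t.
    rewrite !mxE.
    apply: (@norm_le_of_derive _ (fun s => T c1 s 0 j - T c2 s 0 j)
      (fun s => F s (c1 s) 0 j - F s (c2 s) 0 j) b b') => //.
    - by move=> s s01; exact: is_deriveB (dT1 s s01 j) (dT2 s s01 j).
    - move=> s s01; apply: le_trans (bb s s01); apply: le_trans (F_lipschitz _ _ s01).
      by have := rV_coord_le (F s (c1 s) - F s (c2 s)) j; rewrite !mxE.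
    - by rewrite T10 T20 subrr normr0.
  apply: rV_norm_le => //; apply: le_trans b0 _.
  apply: (@nondecreasing_from0 _ b b') => // s s01.
  by apply: le_trans (bb s s01); rewrite mulr_ge0.
have [C C0 pC] : exists2 C, 0 <= C & forall t, 0 <= t <= 1 -> `|p 1%N t - p 0%N t| <= C.
  have [|C C0 HC] := @continuous_bounded_unit_itv R (fun t => `|p 1%N t - p 0%N t|).
    move=> t; apply: (@continuous_comp _ _ _ (fun t => p 1%N t - p 0%N t));
      last exact: norm_continuous.
    by apply: continuousB; exact: pc.
  by exists C => // t /HC; rewrite normr_id.
have e2 (t : R) : is_derive t 1 (fun s => expR (2 * L * s)) (expR (2 * L * t) * (2 * L)).
  exact: is_derive1_comp (is_derive_expR _) (is_derive_mull _ _).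
have step k : forall t, 0 <= t <= 1 ->
    `|p k.+1 t - p k t| <= C * 2^-1 ^+ k * expR (2 * L * t).
  elim: k => [|k ih] t t01.
    apply: le_trans (pC t t01) _; rewrite expr0 mulr1 ler_peMr // -expR0 ler_expR.
    by rewrite !mulr_ge0 //; case/andP: t01.
  rewrite pS // [p k.+1 t]pS //.
  apply: (TD _ _ (fun s => C * 2^-1 ^+ k.+1 * expR (2 * L * s))
      (fun s => C * 2^-1 ^+ k.+1 * (expR (2 * L * s) * (2 * L)))) => //.
  - by rewrite mulr_ge0 ?expR_ge0 // mulr_ge0 // exprn_ge0 // invr_ge0.
  - move=> s s01; apply: le_trans (ler_wpM2l L0 (ih s s01)) _.
    rewrite exprS; set a := 2^-1 ^+ k; set E := expR _.
    have -> : C * (2^-1 * a) * (E * (2 * L)) = (2^-1 * 2) * (L * (C * a * E)) by ring.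
    by rewrite mulVf ?mul1r.
pose B := C * expR (2 * L).
have B0 : 0 <= B by rewrite mulr_ge0 // expR_ge0.
have stepB k t : `|p k.+1 t - p k t| <= B * 2^-1 ^+ k.
  rewrite -(pclamp k.+1) -(pclamp k); apply: le_trans (step k _ (clamp_itv t)) _.
  rewrite /B mulrAC ler_wpM2r ?exprn_ge0 ?invr_ge0 // ler_wpM2l // ler_expR.
  by rewrite ler_piMr ?mulr_ge0 //; case/andP: (clamp_itv t).
have tail k n t : `|p (n + k)%N t - p k t| <= 2 * B * 2^-1 ^+ k.
  (* The exact partial geometric sum, which, unlike the bound it implies, passes through the
     induction on [n]. *)
  suff : `|p (n + k)%N t - p k t| <= 2 * B * 2^-1 ^+ k * (1 - 2^-1 ^+ n).
    move=> /le_trans; apply; rewrite ler_piMr ?mulr_ge0 ?exprn_ge0 ?invr_ge0 //.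
  elim: n => [|n ih]; first by rewrite add0n expr0 !subrr mulr0 normr0.
  rewrite -(subrKA (p (n + k)%N t)) addSn; apply: le_trans (ler_normD _ _) _.
  apply: le_trans (lerD (stepB _ _) ih) _.
  rewrite exprD [2^-1 ^+ n.+1]exprS; set a := 2^-1 ^+ n; set b := 2^-1 ^+ k.
  by rewrite le_eqVlt; apply/orP; left; apply/eqP; field.
have small (b e : R) : 0 < e -> exists k, b * 2^-1 ^+ k < e by exact: geometric_small.
have cvgp t : cvgn (fun k => p k t).
  apply: cauchy_cvg; apply: cauchy_exP => e e0.
  have [k ke] := small (2 * B) e e0.
  exists (p k t); exists k => // n /= kn; rewrite -ball_normE /= distrC.
  by rewrite -(subnK kn); exact: le_lt_trans (tail _ _ _) ke.
pose y t := limn (fun k => p k t).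
have yp k t : `|y t - p k t| <= 2 * B * 2^-1 ^+ k.
  apply/ler_addgt0Pr => e e0.
  have /cvgrPdist_lt/(_ _ e0)[N _ HN] := cvgp t.
  rewrite -(subrKA (p (N + k)%N t)) addrC; apply: le_trans (ler_normD _ _) _.
  by apply: lerD; [exact: tail|apply/ltW; apply: HN; rewrite /= leq_addr].
have yc : continuous y.
  move=> t; apply/cvgrPdist_lt => e e0.
  have e3 : 0 < e / 3 by rewrite divr_gt0.
  have [k ke] := small (2 * B) (e / 3) e3.
  have /cvgrPdist_lt/(_ _ e3) := pc k t.
  apply: filterS => s pts.
  have -> : y t - y s = (y t - p k t) + (p k t - p k s) + (p k s - y s).
    by rewrite !subrKA.
  apply: le_lt_trans (ler_normD _ _) _; apply: le_lt_trans (lerD (ler_normD _ _) (lexx _)) _.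
  have h1 := le_lt_trans (yp k t) ke.
  have := le_lt_trans (yp k s) ke; rewrite distrC => h2.
  lra.
have [H0 dH] := TP _ yc.
have Hy t : 0 <= t <= 1 -> T y t = y t.
  move=> t01; apply/eqP; rewrite -subr_eq0 -normr_le0; apply/ler_addgt0Pr => e e0.
  rewrite add0r.
  have [k ke] := small ((L + 1) * (2 * B)) e e0.
  apply: le_trans (ltW ke).
  have h1 : `|T y t - p k.+1 t| <= L * (2 * B * 2^-1 ^+ k) * t.
    rewrite pS //.
    apply: (TD _ _ (fun s => L * (2 * B * 2^-1 ^+ k) * s) (fun=> L * (2 * B * 2^-1 ^+ k))) => //.
    - by rewrite mulr0.
    - by move=> s _; exact: is_derive_mull.
    - by move=> s _; rewrite ler_wpM2l.
  have h2 := yp k.+1 t; rewrite distrC in h2.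
  rewrite -(subrKA (p k.+1 t)); apply: le_trans (ler_normD _ _) _.
  apply: le_trans (lerD h1 h2) _.
  rewrite exprS; case/andP: t01; set a := 2^-1 ^+ k => t0 t1.
  have a0 : 0 <= a by rewrite exprn_ge0 // invr_ge0.
  have Ba : 0 <= B * a by rewrite mulr_ge0.
  have : L * (2 * B * a) * t <= L * (2 * B * a) * 1.
    by rewrite ler_wpM2l // !mulr_ge0.
  lra.
(* The solution is [T y] and not [y]: they agree on the unit interval, but [y], a limit of clamped
   curves, is constant beyond it and need not have two-sided derivatives at 0 and 1. *)
exists (T y) => // t t01 j; have := dH t t01 j.
by rewrite /= Hy.
Qed.

End Picard.

(** * Smooth dependence on the initial condition *)

Section SmoothBounds.
Context {R : realType} {m : nat}.
Implicit Types (x y z v : 'rV[R]_m) (g : 'rV[R]_m -> R).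

Lemma is_derive_coord x v i : is_derive x v (fun y => y 0 i) (v 0 i).
Proof.
apply/is_derive_cvgP.
apply: (@cvg_trans _ (cst (v 0 i) @ (0 : R)^')); last exact: cvg_cst.
apply: near_eq_cvg; near=> h.
rewrite /= !mxE addrK [_ *: _]mulrA mulVf ?mul1r //.
by near: h; exact: nbhs_dnbhs_neq.
Unshelve. all: by end_near. Qed.

Lemma derive_sum_pd g x v : smooth g -> 'D_v g x = \sum_i v 0 i * pd g i x.
Proof.
move=> sg.
by have [] := @is_derive_comp R _ m g id x v (fun i => v 0 i) sg (is_derive_coord x v).
Qed.

Lemma closed_ball0_compact (r : R) : compact [set x : 'rV[R]_m | `|x| <= r].
Proof.
apply: bounded_closed_compact.
  exists r; split; first exact: num_real.
  by move=> s rs x /= /le_trans; apply; exact: ltW.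
apply: (@closed_comp _ _ (fun x => `|x|) [set s | s <= r]); last exact: closed_le.
by move=> x _; exact: norm_continuous.
Qed.

Lemma continuous_bounded_ball0 g (r : R) : continuous g ->
  exists2 B, 0 <= B & forall x, `|x| <= r -> `|g x| <= B.
Proof.
move=> cg; have [r0|r0] := ltP r 0.
  by exists 0 => // x /(le_lt_trans)/(_ r0); rewrite ltNge normr_ge0.
have [|||c _ mc] := @EVT_max_rV R m (fun x => `|g x|) [set x | `|x| <= r].
- by exists 0; rewrite /= normr0.
- exact: closed_ball0_compact.
- apply: continuous_subspaceT => x; apply: continuous_comp; first exact: cg.
  exact: norm_continuous.
by exists `|g c| => // x xr; apply: mc; rewrite inE.
Qed.

Lemma sum_pd_bound g (r : R) : smooth g -> exists2 L, 0 <= L &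
  forall x v, `|x| <= r -> `|\sum_i v 0 i * pd g i x| <= L * `|v|.
Proof.
move=> sg.
have P i : {B | 0 <= B & forall x, `|x| <= r -> `|pd g i x| <= B}.
  by apply: cid2; apply: continuous_bounded_ball0; apply: smooth_continuous; exact: smooth_derive.
exists (\sum_i s2val (P i)) => [|x v xr].
  by apply: sumr_ge0 => i _; case: (P i).
rewrite mulr_suml; apply: le_trans (ler_norm_sum _ _ _) _; apply: ler_sum => i _.
rewrite normrM mulrC ler_pM // ?rV_coord_le //.
by case: (P i) => B B0 /= HB; exact: HB.
Qed.

Lemma ball0_convex (r s : R) x y :
  0 <= s <= 1 -> `|x| <= r -> `|y| <= r -> `|s *: (y - x) + x| <= r.
Proof.
move=> /andP[s0 s1] xr yr.
have -> : s *: (y - x) + x = s *: y + (1 - s) *: x.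
  by rewrite scalerBr scalerBl scale1r -addrA [- _ + x]addrC.
apply: le_trans (ler_normD _ _) _; rewrite !normrZ.
have -> : r = s * r + (1 - s) * r by ring.
by rewrite (ger0_norm s0) ger0_norm ?subr_ge0 // lerD // ler_wpM2l // subr_ge0.
Qed.

Lemma smooth_lipschitz_ball0 g (r : R) : smooth g -> exists2 L, 0 <= L &
  forall x y, `|x| <= r -> `|y| <= r -> `|g y - g x| <= L * `|y - x|.
Proof.
move=> sg; have [L L0 HL] := sum_pd_bound r sg; exists L => // x y xr yr.
have [s|s s01] := @MVT_line R _ g x (y - x); first exact: smooth_derivable.
rewrite subrK => ->; rewrite derive_sum_pd //; apply: HL.
exact: ball0_convex.
Qed.

(** Strict differentiability at [p] compares any two points near [p], so it serves every base point
    [z] near [p] once the partial derivatives at [p] are exchanged for those at [z], which costs the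
    other half of [e]. Compactness makes [d] uniform. *)
Lemma uniform_differentiability g (K : set 'rV[R]_m) (e : R) :
  smooth g -> compact K -> 0 < e ->
  \forall d \near (0 : R)^'+, forall z, K z -> forall y, `|y - z| < d ->
    `|g y - g z - \sum_i (y 0 i - z 0 i) * pd g i z| <= e * `|y - z|.
Proof.
move=> sg /compact_near_coveringP cK e0.
have e20 : 0 < e / 2 by rewrite divr_gt0.
pose e' := e / 2 / m.+1%:R.
have e'0 : 0 < e' by rewrite divr_gt0.
apply: cK => p _.
have [||d d0 hd] := strict_differentiability _ _ e20 (g := g) (p := p).
- by move=> j x; exact: smooth_derivable.
- by move=> j; apply: smooth_continuous; exact: smooth_derive.
have d20 : 0 < d / 2 by rewrite divr_gt0.
have near_pd : \forall z \near p, forall i, `|pd g i p - pd g i z| <= e'.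
  near=> z => i; move: i; near: z; apply: filter_forall => i.
  have cp : {for p, continuous (pd g i)}.
    by apply: smooth_continuous; exact: smooth_derive.
  by have /cvgrPdist_le := cp; apply.
near=> z i => /= y yz.
have zp : `|z - p| < d / 2.
  near: z; apply/nbhs_ballP; exists (d / 2) => // z.
  by rewrite -ball_normE /= distrC.
have id2 : i < d / 2 by near: i; exact: nbhs_right_lt.
have zpd : `|z - p| < d by lra.
have ypd : `|y - p| < d.
  rewrite -(subrKA z); apply: le_lt_trans (ler_normD _ _) _; lra.
have -> : g y - g z - \sum_i (y 0 i - z 0 i) * pd g i z =
   (g y - g z - \sum_i (y 0 i - z 0 i) * pd g i p) +
   \sum_i (y 0 i - z 0 i) * (pd g i p - pd g i z).
  have -> : \sum_i (y 0 i - z 0 i) * (pd g i p - pd g i z) =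
      \sum_i (y 0 i - z 0 i) * pd g i p - \sum_i (y 0 i - z 0 i) * pd g i z.
    by rewrite -sumrB; apply: eq_bigr => k _; rewrite mulrBr.
  by rewrite subrKA.
apply: le_trans (ler_normD _ _) _.
have -> : e * `|y - z| = e / 2 * `|y - z| + e / 2 * `|y - z| by field.
apply: lerD; first exact: hd.
apply: le_trans (ler_norm_sum _ _ _) _.
apply: (@le_trans _ _ (\sum_(k < m) `|y - z| * e')).
  apply: ler_sum => k _; rewrite normrM ler_pM //.
    by have := rV_coord_le (y - z) k; rewrite !mxE.
  by move: k; near: z; exact: near_pd.
rewrite sumr_const card_ord -[leLHS]mulr_natr -[leLHS]mulrA [leLHS]mulrC ler_wpM2r // /e'.
by rewrite mulrAC ler_pdivrMr ?ltr0n // ler_wpM2l ?(ltW e20) // ler_nat.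
Unshelve. all: by end_near. Qed.

End SmoothBounds.

(** * Flows and their tangent flows *)

Section Flows.
Context {R : realType}.

Definition smooth_coords {m} (Y : 'rV[R]_m -> 'rV[R]_m) :=
  forall j, smooth (fun x => Y x 0 j).

(** Takes the place of a global Lipschitz condition on the field. The tangent field need not inherit
    such a condition, since it multiplies derivatives of [Y] by the unbounded vector [v], whereas
    boundedness on balls passes to the tangent flow. *)
Definition locally_bounded_flow {m} (Phi : 'rV[R]_m -> R -> 'rV[R]_m) :=
  forall r : R, exists r' : R, forall x t,
    `|x| <= r -> 0 <= t <= 1 -> `|Phi x t| <= r'.

Definition flow_of {m} (Y : 'rV[R]_m -> 'rV[R]_m) (Phi : 'rV[R]_m -> R -> 'rV[R]_m) :=
  [/\ smooth_coords Y, forall x, Phi x 0 = x,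
      forall x, has_velocity (Phi x) (fun t => Y (Phi x t)) &
      locally_bounded_flow Phi].

Lemma field_lipschitz m (Y : 'rV[R]_m -> 'rV[R]_m) (r : R) : smooth_coords Y ->
  exists2 L, 0 <= L &
    forall x y, `|x| <= r -> `|y| <= r -> `|Y y - Y x| <= L * `|y - x|.
Proof.
move=> sY.
pose P j := cid2 (smooth_lipschitz_ball0 r (sY j)).
have P0 j : 0 <= s2val (P j) by case: (P j).
exists (\sum_j s2val (P j)) => [|x y xr yr]; first by apply: sumr_ge0.
apply: rV_norm_le => [|j]; first by rewrite mulr_ge0 // sumr_ge0.
rewrite !mxE; apply: (@le_trans _ _ (s2val (P j) * `|y - x|)).
  by case: (P j) => B B0 /= HB; exact: HB.
by rewrite ler_wpM2r // (bigD1 j) //= lerDl sumr_ge0.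
Qed.

Definition linearized {m} (Y : 'rV[R]_m -> 'rV[R]_m) (x v : 'rV[R]_m) : 'rV[R]_m :=
  \row_j \sum_i v 0 i * pd (fun x => Y x 0 j) i x.

Lemma linearizedB m (Y : 'rV[R]_m -> 'rV[R]_m) x u v :
  linearized Y x (u - v) = linearized Y x u - linearized Y x v.
Proof.
apply/rowP => j; rewrite !mxE -sumrB; apply: eq_bigr => i _.
by rewrite !mxE mulrBl.
Qed.

Lemma linearizedZ m (Y : 'rV[R]_m -> 'rV[R]_m) x a v :
  linearized Y x (a *: v) = a *: linearized Y x v.
Proof.
apply/rowP => j; rewrite !mxE mulr_sumr; apply: eq_bigr => i _.
by rewrite !mxE mulrA.
Qed.

Lemma linearized_bound m (Y : 'rV[R]_m -> 'rV[R]_m) (r : R) : smooth_coords Y ->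
  exists2 L, 0 <= L & forall x v, `|x| <= r -> `|linearized Y x v| <= L * `|v|.
Proof.
move=> sY.
pose P j := cid2 (sum_pd_bound r (sY j)).
have P0 j : 0 <= s2val (P j) by case: (P j).
exists (\sum_j s2val (P j)) => [|x v xr]; first by apply: sumr_ge0.
apply: rV_norm_le => [|j]; first by rewrite mulr_ge0 // sumr_ge0.
rewrite !mxE; apply: (@le_trans _ _ (s2val (P j) * `|v|)).
  by case: (P j) => B B0 /= HB; exact: HB.
by rewrite ler_wpM2r // (bigD1 j) //= lerDl sumr_ge0.
Qed.

(** Trajectories issued from the ball of radius [r] stay in a ball on which [Y] is Lipschitz, and
    Gronwall's inequality with [e = 0] applies to their difference. *)
Lemma flow_lipschitz m (Y : 'rV[R]_m -> 'rV[R]_m) Phi (r : R) : flow_of Y Phi ->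
  exists2 K, 0 <= K & forall x y t, `|x| <= r -> `|y| <= r -> 0 <= t <= 1 ->
    `|Phi y t - Phi x t| <= K * `|y - x|.
Proof.
move=> [sY P0 dP bP]; have [r' Hr'] := bP r.
have [L L0 HL] := field_lipschitz r' sY.
have [K K0 HK] := @gronwall R m L L0; exists K => // x y t xr yr t01.
have := HK (fun t => Phi y t - Phi x t) (fun t => Y (Phi y t) - Y (Phi x t)) 0.
rewrite !P0 addr0; apply => // s s01.
- move=> j; have := is_deriveB (dP y s s01 j) (dP x s s01 j).
  rewrite !mxE; congr (is_derive _ _ _ _).
  by apply/funext => u; rewrite !mxE.
- by rewrite addr0; apply: HL; exact: Hr'.
Qed.

(* Its flow is the derivative of the flow of [Y] in the initial condition. *)
Definition tangent_field {m} (Y : 'rV[R]_m -> 'rV[R]_m) (z : 'rV[R]_(m + m)) :=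
  row_mx (Y (lsubmx z)) (linearized Y (lsubmx z) (rsubmx z)).

Lemma smooth_lsubmx_comp m k (g : 'rV[R]_m -> R) : smooth g ->
  smooth (fun z : 'rV[R]_(m + k) => g (lsubmx z)).
Proof.
move=> sg; apply: (smooth_comp (c := @lsubmx _ 1 m k)) => // i.
have -> : (fun z : 'rV[R]_(m + k) => lsubmx z 0 i) = fun z => z 0 (lshift k i).
  by apply/funext => z; rewrite mxE.
exact: smooth_coord.
Qed.

Lemma smooth_rsubmx_comp m k (g : 'rV[R]_m -> R) : smooth g ->
  smooth (fun z : 'rV[R]_(k + m) => g (rsubmx z)).
Proof.
move=> sg; apply: (smooth_comp (c := @rsubmx _ 1 k m)) => // i.
have -> : (fun z : 'rV[R]_(k + m) => rsubmx z 0 i) = fun z => z 0 (rshift k i).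
  by apply/funext => z; rewrite mxE.
exact: smooth_coord.
Qed.

Lemma smooth_tangent_field m (Y : 'rV[R]_m -> 'rV[R]_m) :
  smooth_coords Y -> smooth_coords (tangent_field Y).
Proof.
move=> sY j; case: (split_ordP j) => k ->{j}.
  have -> : (fun z => tangent_field Y z 0 (lshift m k)) = fun z => Y (lsubmx z) 0 k.
    by apply/funext => z; rewrite row_mxEl.
  exact: smooth_lsubmx_comp (sY k).
have -> : (fun z => tangent_field Y z 0 (rshift m k)) = fun z =>
    \sum_i z 0 (rshift m i) * pd (fun x => Y x 0 k) i (lsubmx z).
  apply/funext => z; rewrite row_mxEr mxE; apply: eq_bigr => i _.
  by rewrite [rsubmx z 0 i]mxE.
apply: smooth_sum => i; apply: smoothM; first exact: smooth_coord.
exact: smooth_lsubmx_comp (smooth_derive _ (sY k)).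
Qed.

Lemma row_mx_norm_le m k (x : 'rV[R]_m) (y : 'rV[R]_k) (a b : R) :
  `|x| <= a -> `|y| <= b -> `|row_mx x y| <= a + b.
Proof.
move=> xa yb.
have a0 : 0 <= a by exact: le_trans xa.
have b0 : 0 <= b by exact: le_trans yb.
apply: rV_norm_le => [|j]; first exact: addr_ge0.
case: (split_ordP j) => i ->; rewrite ?row_mxEl ?row_mxEr.
  by apply: le_trans (rV_coord_le _ _) _; lra.
by apply: le_trans (rV_coord_le _ _) _; lra.
Qed.

Lemma submx_norm_le m k (z : 'rV[R]_(m + k)) : `|lsubmx z| <= `|z| /\ `|rsubmx z| <= `|z|.
Proof. by split; apply: rV_norm_le => // j; rewrite mxE; exact: rV_coord_le. Qed.

(** Along a given trajectory of [Y] the second block obeys a linear equation, globally Lipschitz in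
    the unknown; Picard's theorem therefore applies for each initial point separately. *)
Lemma tangent_flow_exists m (Y : 'rV[R]_m -> 'rV[R]_m) Phi : flow_of Y Phi ->
  exists2 Psi, flow_of (tangent_field Y) Psi &
    forall z t, lsubmx (Psi z t) = Phi (lsubmx z) t.
Proof.
move=> [sY P0 dP bP].
have ex z : exists2 eta : R -> 'rV[R]_m, eta 0 = rsubmx z &
    has_velocity eta (fun t => linearized Y (Phi (lsubmx z) (clamp t)) (eta t)).
  have [r' Hr'] := bP `|lsubmx z|.
  have [L L0 HL] := linearized_bound r' sY.
  apply: (@ode_exists R m (fun t v => linearized Y (Phi (lsubmx z) (clamp t)) v) L) => //.
  - move=> c cc t; apply/rV_continuousP => j.
    have -> : (fun s => linearized Y (Phi (lsubmx z) (clamp s)) (c s) 0 j) =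
        fun s => \sum_i c s 0 i * pd (fun x => Y x 0 j) i (Phi (lsubmx z) (clamp s)).
      by apply/funext => s; rewrite mxE.
    apply: cvg_big => [|i _]; first exact: add_continuous.
    apply: cvgM; first exact: ((rV_continuousP c t).1 (cc t) i).
    apply: (@continuous_comp _ _ _ (Phi (lsubmx z) \o clamp) (pd (fun x => Y x 0 j) i)).
      exact: (velocity_clamp_continuous (dP _)).
    by apply: smooth_continuous; exact: smooth_derive.
  - move=> s u v s01; rewrite -linearizedB; apply: HL.
    by apply: Hr' => //; exact: clamp_itv.
pose eta z := s2val (cid2 (ex z)).
have eta0 z : eta z 0 = rsubmx z by rewrite /eta; case: cid2.
have deta z : has_velocity (eta z) (fun t => linearized Y (Phi (lsubmx z) t) (eta z t)).
  rewrite /eta; case: cid2 => e /= _ de t t01 j.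
  by have := de t t01 j; rewrite clamp_id.
exists (fun z t => row_mx (Phi (lsubmx z) t) (eta z t)); last first.
  by move=> z t; rewrite row_mxKl.
split.
- exact: smooth_tangent_field.
- by move=> z; rewrite P0 eta0 hsubmxK.
- move=> z t t01 j; rewrite /tangent_field row_mxKl row_mxKr.
  case: (split_ordP j) => k ->.
    have -> : (fun s => row_mx (Phi (lsubmx z) s) (eta z s) 0 (lshift m k)) =
      fun s => Phi (lsubmx z) s 0 k by apply/funext => s; rewrite row_mxEl.
    by rewrite row_mxEl; exact: dP.
  have -> : (fun s => row_mx (Phi (lsubmx z) s) (eta z s) 0 (rshift m k)) =
    fun s => eta z s 0 k by apply/funext => s; rewrite row_mxEr.
  by rewrite row_mxEr; exact: deta.
- move=> r; have [r' Hr'] := bP r.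
  have [L L0 HL] := linearized_bound r' sY.
  have [K K0 HK] := @gronwall R m L L0.
  exists (r' + K * r) => z t zr t01; have [lz rz] := submx_norm_le z.
  apply: row_mx_norm_le; first by apply: Hr' => //; exact: le_trans zr.
  apply: le_trans (HK _ _ 0 _ (deta z) _ t t01) _ => //.
    move=> s s01; rewrite addr0; apply: HL; apply: Hr' => //; exact: le_trans zr.
  by rewrite eta0 addr0 ler_wpM2l // (le_trans rz).
Qed.

(** The error [c] of the first-order expansion starts at 0 and solves the linearized equation up to
    [e1 * |Phi x' - Phi x|], itself at most a constant times [e1 * |h|]. By Gronwall's inequality
    [c 1] is then small relative to [h]. *)
Lemma flow_is_derive m (Y : 'rV[R]_m -> 'rV[R]_m) Phi Psi : flow_of Y Phi ->
  flow_of (tangent_field Y) Psi -> (forall z t, lsubmx (Psi z t) = Phi (lsubmx z) t) ->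
  forall x v j, is_derive x v (fun x => Phi x 1 0 j) (Psi (row_mx x v) 1 0 (rshift m j)).
Proof.
move=> fP [_ Q0 dQ _] PQ x v j; have [sY P0 dP bP] := fP.
pose eta t := rsubmx (Psi (row_mx x v) t).
have PQx t : lsubmx (Psi (row_mx x v) t) = Phi x t by rewrite PQ row_mxKl.
have eta0 : eta 0 = v by rewrite /eta Q0 row_mxKr.
have deta : has_velocity eta (fun t => linearized Y (Phi x t) (eta t)).
  move=> t t01 k; have := dQ (row_mx x v) t t01 (rshift m k).
  rewrite /tangent_field PQx row_mxEr -/(eta t).
  congr (is_derive _ _ _ _); apply/funext => s; by rewrite /eta mxE.
(* A ball containing [h *: v + x] whenever [|h| <= 1]. *)
pose r := `|x| + `|v|.
have [K1 K10 HK1] := flow_lipschitz r fP.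
have [r' Hr'] := bP r.
have [L L0 HL] := linearized_bound r' sY.
have [K K0 HK] := @gronwall R m L L0.
have xr : `|x| <= r by rewrite lerDl.
apply/is_derive_cvgP/cvgrPdist_le => e e0.
(* The linearization error gets multiplied by the Gronwall constant [K], the Lipschitz constant [K1]
   of the flow and [|v|]; the 1 guards against a zero product. *)
pose e1 := e / (K * K1 * `|v| + 1).
have den0 : 0 < K * K1 * `|v| + 1 by rewrite ltr_wpDl // !mulr_ge0.
have e10 : 0 < e1 by rewrite divr_gt0.
have : \forall d \near (0 : R)^'+, forall z, `|z| <= r' -> forall y, `|y - z| < d ->
    forall k, `|Y y 0 k - Y z 0 k - linearized Y z (y - z) 0 k| <= e1 * `|y - z|.
  near=> d => z zr y yz k; move: z zr y yz; move: k; near: d; apply: filter_forall => k.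
  have := uniform_differentiability (sY k) (@closed_ball0_compact R m r') e10.
  apply: filterS => d Hd z zr y yz; have := Hd z zr y yz.
  rewrite mxE; congr (`| _ - _ | <= _); apply: eq_bigr => i _; by rewrite !mxE.
move=> nd.
have [d [d0 Hd]] := filter_ex (filterI (nbhs_right_gt (0 : R)) nd).
near=> h.
have h0 : h != 0 by near: h; exact: nbhs_dnbhs_neq.
have h1 : `|h| <= 1 by near: h; exact: (@dnbhs0_le R R).
have hd : `|h| < d / (K1 * `|v| + 1).
  by near: h; apply: (@dnbhs0_lt R R); rewrite divr_gt0 // ltr_wpDl // mulr_ge0.
set x' := h *: v + x.
have x'r : `|x'| <= r.
  rewrite /r addrC; apply: le_trans (ler_normD _ _) _.
  by rewrite lerD2r normrZ ler_piMl.
have x'x : `|x' - x| = `|h| * `|v| by rewrite addrK normrZ.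
pose c t := Phi x' t - Phi x t - h *: eta t.
have dc : has_velocity c
    (fun t => Y (Phi x' t) - Y (Phi x t) - linearized Y (Phi x t) (h *: eta t)).
  move=> t t01 k; rewrite linearizedZ.
  have := is_deriveB (is_deriveB (dP x' t t01 k) (dP x t t01 k)) (is_deriveZ h (deta t t01 k)).
  congr (is_derive _ _ _ _).
    by apply/funext => s; rewrite /c; move: (eta) => w; rewrite !mxE.
  by rewrite !mxE.
have : `|c 1| <= K * (`|c 0| + e1 * (K1 * (`|h| * `|v|))).
  apply: HK dc _ _ _; rewrite ?ler01 ?lexx //.
    by rewrite mulr_ge0 ?(ltW e10) // !mulr_ge0.
  move=> t t01.
  have -> : Y (Phi x' t) - Y (Phi x t) - linearized Y (Phi x t) (h *: eta t) =
      linearized Y (Phi x t) (c t) +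
      (Y (Phi x' t) - Y (Phi x t) - linearized Y (Phi x t) (Phi x' t - Phi x t)).
    rewrite /c [in X in _ = X + _]linearizedB.
    by rewrite [RHS]addrC subrKA.
  apply: le_trans (ler_normD _ _) _; apply: lerD.
    by apply: HL; exact: Hr'.
  have Pd : `|Phi x' t - Phi x t| <= K1 * (`|h| * `|v|) by rewrite -x'x; exact: HK1.
  apply: (@le_trans _ _ (e1 * `|Phi x' t - Phi x t|)); last by rewrite ler_wpM2l // ltW.
  apply: rV_norm_le => [|k]; first by rewrite mulr_ge0 // ltW.
  have := Hd (Phi x t) (Hr' _ _ xr t01) (Phi x' t) _ k.
  rewrite !mxE; apply; apply: le_lt_trans Pd _.
  rewrite ltr_pdivlMr ?ltr_wpDl ?mulr_ge0 // in hd.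
  apply: le_lt_trans hd; rewrite mulrDr mulr1 mulrCA lerDl //.
have -> : c 0 = 0 by rewrite /c !P0 eta0 addrK subrr.
rewrite normr0 add0r => c1.
have -> : Psi (row_mx x v) 1 0 (rshift m j) -
    h^-1 *: (((fun x => Phi x 1 0 j) \o shift x) (h *: v) - Phi x 1 0 j) =
    - (h^-1 * c 1 0 j).
  rewrite /c /eta /= !mxE /GRing.scale /= -/x'.
  by field.
rewrite normrN normrM normfV ler_pdivrMl ?normr_gt0 //.
apply: le_trans (rV_coord_le _ _) _; apply: le_trans c1 _.
have -> : K * (e1 * (K1 * (`|h| * `|v|))) = `|h| * (e1 * (K * K1 * `|v|)) by ring.
rewrite ler_wpM2l // /e1 mulrAC ler_pdivrMr // ler_wpM2l ?(ltW e0) //.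
by rewrite lerDl.
Unshelve. all: by end_near. Qed.

Lemma flow_continuous m (Y : 'rV[R]_m -> 'rV[R]_m) Phi : flow_of Y Phi ->
  forall j, continuous (fun x => Phi x 1 0 j).
Proof.
move=> fP j x.
suff H (e : R) : 0 < e -> \forall y \near x, `|Phi x 1 0 j - Phi y 1 0 j| <= e.
  exact: (iffRL (@cvgrPdist_le R R _ (nbhs x) (nbhs_filter x) (fun x => Phi x 1 0 j) _) H).
move=> e0; have [K K0 HK] := flow_lipschitz (`|x| + 1) fP.
have e'0 : 0 < Num.min 1 (e / (K + 1)).
  by rewrite lt_min ltr01 divr_gt0 // ltr_wpDl.
apply/nbhs_ballP; exists (Num.min 1 (e / (K + 1))) => // y.
rewrite -ball_normE /= lt_min => /andP[y1 ye].
have yx : `|y| <= `|x| + 1.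
  rewrite -[y](subrKC x); apply: le_trans (ler_normD _ _) _.
  by rewrite lerD2l distrC ltW.
have : `|(Phi x 1 - Phi y 1) 0 j| <= e.
  apply: le_trans (rV_coord_le _ _) _; apply: le_trans (HK y x 1 yx _ _) _.
  + by rewrite lerDl.
  + by rewrite lexx ler01.
  + rewrite ltr_pdivlMr ?ltr_wpDl // in ye; have := normr_ge0 (x - y); nra.
by rewrite !mxE.
Qed.

(* Directional derivatives of the time-one map are read off the tangent flow,
   which is again a flow: the class of all such functions is stable. *)
Lemma flow_smooth m (Y : 'rV[R]_m -> 'rV[R]_m) Phi : flow_of Y Phi ->
  forall j, smooth (fun x => Phi x 1 0 j).
Proof.
move=> fP j.
(* The affine map [A], with linear part [A'], is there because a derivative along [v] evaluates the
   tangent flow at [(A x, A' v)]: each differentiation appends a constant block. *)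
pose C := [set f : 'rV[R]_m -> R | exists k (Z : 'rV[R]_k -> 'rV[R]_k) Psi
    (A A' : 'rV[R]_m -> 'rV[R]_k) i,
  [/\ flow_of Z Psi, forall i, continuous (fun x => A x 0 i),
      forall (h : R) v x, A (h *: v + x) = h *: A' v + A x &
      f = fun x => Psi (A x) 1 0 i]].
have D f v : C f -> exists2 f', C f' & forall x, is_derive x v f (f' x).
  move=> [k [Z [Psi [A [A' [i [fZ cA lA ->]]]]]]].
  have [T fT PT] := tangent_flow_exists fZ.
  exists (fun x => T (row_mx (A x) (A' v)) 1 0 (rshift k i)) => [|x].
    exists (k + k)%N, (tangent_field Z), T, (fun x => row_mx (A x) (A' v)),
      (fun v => row_mx (A' v) 0), (rshift k i).
    split=> // [a|h u x]; last first.
      by rewrite scale_row_mx add_row_mx scaler0 add0r lA.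
    case: (split_ordP a) => b ->.
      have -> : (fun x => row_mx (A x) (A' v) 0 (lshift k b)) = fun x => A x 0 b.
        by apply/funext => x; rewrite row_mxEl.
      exact: cA.
    have -> : (fun x => row_mx (A x) (A' v) 0 (rshift k b)) = fun x => A' v 0 b.
      by apply/funext => x; rewrite row_mxEr.
    exact: cst_continuous.
  apply: is_derive_line0.
  have := @is_derive_line _ _ _ (fun y => Psi y 1 0 i) (A x) (A' v) 0.
  rewrite scale0r add0r => /(_ _ (flow_is_derive fZ fT PT (A x) (A' v) i)).
  congr (is_derive _ _ _ _).
  by apply/funext => h; rewrite lA.
apply: (@smooth_class _ _ _ C) => [f|f x v|f v|].
- move=> [k [Z [Psi [A [A' [i [fZ cA _ ->]]]]]]] x.
  have cA' : {for x, continuous A} by apply/rV_continuousP => a; exact: cA.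
  apply: (@continuous_comp _ _ _ A (fun y => Psi y 1 0 i)) => //.
  exact: flow_continuous fZ _ _.
- by move=> /(D _ v)[f' _ /(_ x)[]].
- move=> /(D _ v)[f' Cf' df'].
  by have -> : (fun x => 'D_v f x) = f' by apply/funext => x; case: (df' x).
- exists m, Y, Phi, id, id, j; split=> // i; exact: coord_continuous.
Qed.

End Flows.

(** * Smooth cut-off functions *)

Section FlatFunction.
Context {R : realType}.
Implicit Types (p : {poly R}) (s : R).

(* The polynomial factor makes the family stable under differentiation. *)
Definition flat p s : R := if 0 < s then p.[s^-1] * expR (- s^-1) else 0.

(** Termwise, from [y ^ i <= i! * expR y]. At [y = 1 / s] it says that [expR (- 1 / s)] beats every
    power of [1 / s]. *)
Lemma horner_exp_bounded p : exists2 B : R, 0 <= B &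
  forall y : R, 0 <= y -> `|p.[y] * expR (- y)| <= B.
Proof.
exists (\sum_(i < size p) `|p`_i| * i`!%:R) => [|y y0].
  by apply: sumr_ge0 => i _; rewrite mulr_ge0.
rewrite horner_coef mulr_suml; apply: le_trans (ler_norm_sum _ _ _) _.
apply: ler_sum => i _; rewrite -mulrA normrM ler_wpM2l //.
rewrite ger0_norm ?mulr_ge0 ?exprn_ge0 ?expR_ge0 //.
rewrite expRN ler_pdivrMr ?expR_gt0 //.
have [->|i0] := posnP i; first by rewrite expr0 mul1r -expR0 ler_expR.
have := expR_ge1Dxn (i.-1) y0; rewrite prednK // => H.
rewrite mulrC -ler_pdivrMr ?ltr0n ?fact_gt0 //; apply: le_trans H.
by rewrite lerDr.
Qed.

Lemma flat_bounded p : exists2 B : R, 0 <= B & forall s, `|flat p s| <= B.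
Proof.
have [B B0 HB] := horner_exp_bounded p; exists B => // s.
rewrite /flat; case: ltP => [s0|_]; last by rewrite normr0.
by apply: HB; rewrite invr_ge0 ltW.
Qed.

(** The factor ['X^2] comes from the derivative of [1 / s]. At 0 the difference quotient is [h]
    times the bounded function [flat ('X^2 * p)] at [h]. *)
Lemma is_derive_flat p s : is_derive s 1 (flat p) (flat ('X^2 * (p - p^`())) s).
Proof.
have [s0|s0|->] := ltgtP s 0.
- rewrite {2}/flat ltNge (ltW s0) /=.
  apply: (@near_eq_is_derive R R R (cst 0)).
  near=> u; rewrite /flat /= ltNge (_ : u <= 0) //.
  by apply/ltW; near: u; exact: lt_nbhsl.
- rewrite {2}/flat s0.
  apply: (@near_eq_is_derive R R R (fun u => p.[u^-1] * expR (- u^-1))).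
    near=> u; rewrite /flat (_ : 0 < u) //.
    by near: u; exact: lt_nbhsr.
  have sn0 : s != 0 by rewrite gt_eqF.
  have dV : is_derive s 1 (fun u : R => u^-1) (- s ^- 2).
    by have := @is_deriveV R id s 1 1 sn0 (is_derive_id _ _); rewrite [_ *: 1]mulr1.
  have dp : is_derive s 1 (fun u : R => p.[u^-1]) (p^`().[s^-1] * - s ^- 2).
    exact: (is_derive1_comp (is_derive_poly p s^-1) dV).
  have de : is_derive s 1 (fun u : R => expR (- u^-1)) (expR (- s^-1) * - - s ^- 2).
    exact: (is_derive1_comp (is_derive_expR _) (is_deriveN dV)).
  apply: is_derive_eq; rewrite /GRing.scale /= hornerM hornerXn hornerD hornerN.
  by rewrite exprVn; ring.
- apply/is_derive_cvgP.
  have -> : flat ('X^2 * (p - p^`())) 0 = 0 by rewrite /flat ltxx.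
  have [B B0 HB] := flat_bounded ('X^2 * p).
  apply/cvgr0Pnorm_le => e e0; near=> h.
  have h0 : h != 0 by near: h; exact: nbhs_dnbhs_neq.
  have he : `|h| <= e / (B + 1).
    by near: h; apply: (@dnbhs0_le R R); rewrite divr_gt0 // ltr_wpDl.
  have -> : h^-1 *: ((flat p \o shift 0) h%:A - flat p 0) = h * flat ('X^2 * p) h.
    rewrite /= addr0 [h%:A]mulr1 /flat ltxx subr0; case: ltP => _; last by rewrite scaler0 mulr0.
    rewrite hornerM hornerXn /GRing.scale /= mulrA [RHS]mulrA; congr (_ * _).
    by field.
  rewrite normrM; have := HB h; rewrite ler_pdivlMr ?ltr_wpDl // in he.
  have := normr_ge0 h; nra.
Unshelve. all: by end_near. Qed.

Lemma smooth_flat p : smooth (flat p).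
Proof.
pose C := [set f : R -> R | exists q, f = flat q].
apply: (@smooth_class _ _ _ C) => [f|f x v|f v|]; last by exists p.
- move=> [q ->] x; apply/differentiable_continuous/derivable1_diffP.
  by case: (is_derive_flat q x).
- move=> [q ->]; have := is_derive_scale v (is_derive_flat q x).
  by rewrite [v *: 1]mulr1; case.
- move=> [q ->]; exists (v *: ('X^2 * (q - q^`()))); apply/funext => x.
  have := is_derive_scale v (is_derive_flat q x); rewrite [v *: 1]mulr1 => -[_ ->].
  by rewrite /flat; case: ifP; rewrite ?mulr0 // hornerZ mulrA.
Qed.

Lemma flat1_ge0 s : 0 <= flat 1 s.
Proof. by rewrite /flat hornerE mul1r; case: ifP; rewrite // expR_ge0. Qed.

Lemma flat1_eq0 s : (flat 1 s == 0) = (s <= 0).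
Proof.
by rewrite /flat hornerE mul1r; case: ltP; rewrite ?eqxx // gt_eqF // expR_gt0.
Qed.

Lemma flat1_gt0 s : (0 < flat 1 s) = (0 < s).
Proof. by rewrite lt_neqAle eq_sym flat1_eq0 flat1_ge0 andbT -ltNge. Qed.

Definition cutoff (a s : R) := flat 1 (a + 1 - s) / (flat 1 (a + 1 - s) + flat 1 (s - a)).

Lemma cutoff_den (a s : R) : flat 1 (a + 1 - s) + flat 1 (s - a) != 0.
Proof.
rewrite paddr_eq0 ?flat1_ge0 // !flat1_eq0; apply/negP => /andP[]; lra.
Qed.

Lemma cutoff_eq1 (a s : R) : s <= a -> cutoff a s = 1.
Proof.
move=> sa; have := cutoff_den a s; rewrite /cutoff.
have -> : flat 1 (s - a) = 0 by apply/eqP; rewrite flat1_eq0 subr_le0.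
by rewrite addr0; exact: divff.
Qed.

Lemma cutoff_eq0 (a s : R) : a + 1 <= s -> cutoff a s = 0.
Proof.
by move=> sa; rewrite /cutoff (_ : flat 1 (a + 1 - s) = 0) ?mul0r //;
  apply/eqP; rewrite flat1_eq0 subr_le0.
Qed.

Lemma smooth_cutoff (V : normedModType R) (a : R) (f : V -> R) :
  smooth f -> smooth (fun x => cutoff a (f x)).
Proof.
move=> sf.
have s1 : smooth (fun x => flat 1 (a + 1 - f x)).
  apply: (smooth_comp1 (c := fun x => a + 1 - f x)); first exact: smooth_flat.
  by apply: smoothB => //; exact: smooth_cst.
apply: smoothM => //; apply: smoothV => [x|]; first exact: cutoff_den.
apply: smoothD => //.
apply: (smooth_comp1 (c := fun x => f x - a)); first exact: smooth_flat.
by apply: smoothB => //; exact: smooth_cst.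
Qed.

End FlatFunction.

(** * Flow of a compactly supported field *)

Lemma has_velocity_rev (R : realType) n (c c' : R -> 'rV[R]_n) : has_velocity c c' ->
  has_velocity (fun s => c (1 - s)) (fun s => - c' (1 - s)).
Proof.
move=> dc s s01 j.
have d1 : is_derive s 1 (fun s : R => 1 - s) (-1).
  have := is_deriveB (is_derive_cst (1 : R) s 1) (is_derive_id s 1).
  by rewrite sub0r.
have s01' : 0 <= 1 - s <= 1 by case/andP: s01 => ? ?; apply/andP; split; lra.
have := is_derive1_comp (f := fun u => c u 0 j) (g := fun s : R => 1 - s) (dc (1 - s) s01' j) d1.
by rewrite mulrN1 mxE.
Qed.

Section FlowMap.
Context {R : realType} {n : nat}.
Variables (Y : 'rV[R]_n -> 'rV[R]_n) (r : R).
Hypothesis Y_smooth : smooth_coords Y.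
Hypothesis Y_support : forall x, r < `|x| -> Y x = 0.

(** On the ball of radius [|r| + 1] smoothness gives a Lipschitz constant. A point outside that ball
    is at distance at least 1 from every point where the field is nonzero, so there the bound [B] is
    itself a Lipschitz constant. *)
Lemma supported_bounds : exists B L : R, [/\ 0 <= B, 0 <= L,
  forall x, `|Y x| <= B & forall x y, `|Y x - Y y| <= L * `|x - y|].
Proof.
pose r1 := `|r| + 1.
have [L L0 HL] := field_lipschitz r1 Y_smooth.
have r10 : 0 <= r1 by rewrite addr_ge0.
have Y0 x : `|r| < `|x| -> Y x = 0.
  by move=> rx; apply: Y_support; apply: le_lt_trans rx; exact: ler_norm.
have r1r : `|r| < r1 by rewrite ltrDl.
pose B := `|Y 0| + L * r1.
have B0 : 0 <= B by rewrite addr_ge0 // mulr_ge0.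
have YB x : `|Y x| <= B.
  have [xr|/(lt_trans r1r)/Y0 ->] := leP `|x| r1; last by rewrite normr0.
  rewrite -(subrKC (Y 0) (Y x)); apply: le_trans (ler_normD _ _) _.
  rewrite lerD2l; apply: le_trans (HL 0 x _ xr) _; first by rewrite normr0.
  by rewrite subr0 ler_wpM2l.
have far x y : r1 < `|x| -> `|Y x - Y y| <= B * `|x - y|.
  move=> xr; rewrite (Y0 x (lt_trans r1r xr)) sub0r normrN.
  have [yr|/Y0 ->] := leP `|y| `|r|; last by rewrite normr0 mulr_ge0.
  apply: le_trans (YB y) _; rewrite ler_peMr //.
  have := ler_dist_dist x y; have := ler_norm (`|x| - `|y|); rewrite /r1 in xr; lra.
exists B, (L + B); split=> // [|x y]; first exact: addr_ge0.
rewrite mulrDl.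
have [xr|xr] := leP `|x| r1; last first.
  by apply: le_trans (far _ _ xr) _; rewrite lerDr mulr_ge0.
have [yr|yr] := leP `|y| r1; last first.
  by rewrite distrC [`|x - y|]distrC; apply: le_trans (far _ _ yr) _; rewrite lerDr mulr_ge0.
by apply: le_trans (HL _ _ yr xr) _; rewrite lerDl mulr_ge0.
Qed.

Lemma trajectory_unique (t : R) (c d : R -> 'rV[R]_n) :
  has_velocity c (fun s => t *: Y (c s)) -> has_velocity d (fun s => t *: Y (d s)) ->
  c 0 = d 0 -> c 1 = d 1.
Proof.
move=> dc dd cd0.
have [_ [L [_ L0 _ HL]]] := supported_bounds.
have [K K0 HK] := @gronwall R n (`|t| * L) (mulr_ge0 (normr_ge0 _) L0).
have := HK (fun s => c s - d s) (fun s => t *: Y (c s) - t *: Y (d s)) 0 _ _ _ 1.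
rewrite cd0 subrr normr0 addr0 mulr0 lexx ler01 => H.
apply/eqP; rewrite -subr_eq0 -normr_le0; apply: H => // s s01.
- move=> j; have := is_deriveB (dc s s01 j) (dd s s01 j).
  congr (is_derive _ _ _ _); last by rewrite !mxE.
  by apply/funext => u; rewrite !mxE.
- by rewrite addr0 -scalerBr normrZ -mulrA ler_wpM2l.
Qed.

(* The time is turned into an extra coordinate with zero velocity, so that the
   family of flows is a single time-one map. *)
Lemma flow_map_exists : exists E : R -> 'rV[R]_n -> 'rV[R]_n,
  (forall t x, exists c, [/\ c 0 = x, c 1 = E t x &
    has_velocity c (fun s => t *: Y (c s))]) /\
  forall (V : normedModType R) (x : V -> 'rV[R]_n) (t : V -> R),
    (forall i, smooth (fun p => x p 0 i)) -> smooth t ->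
    forall j, smooth (fun p => E (t p) (x p) 0 j).
Proof.
have [B [L [B0 L0 HB HL]]] := supported_bounds.
have Yc : continuous Y.
  by move=> x; apply/rV_continuousP => j; exact: (smooth_continuous (Y_smooth j)).
have ex (t : R) (x : 'rV[R]_n) : exists2 c : R -> 'rV[R]_n, c 0 = x &
    has_velocity c (fun s => t *: Y (c s)).
  apply: (@ode_exists R n (fun s v => t *: Y v) (`|t| * L)).
  - move=> c cc s; apply: cvgZl_tmp; apply: (@continuous_comp _ _ _ c Y); [exact: cc|exact: Yc].
  - by rewrite mulr_ge0.
  - by move=> s u v _; rewrite -scalerBr normrZ -mulrA ler_wpM2l.
pose c t x := s2val (cid2 (ex t x)).
have c0 t x : c t x 0 = x by rewrite /c; case: cid2.
have dc t x : has_velocity (c t x) (fun s => t *: Y (c t x s)).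
  by rewrite /c; case: cid2.
pose tau (z : 'rV[R]_(1 + n)) := z 0 (lshift n 0).
pose Z (z : 'rV[R]_(1 + n)) : 'rV[R]_(1 + n) := row_mx 0 (tau z *: Y (rsubmx z)).
pose Phi (z : 'rV[R]_(1 + n)) s : 'rV[R]_(1 + n) :=
  row_mx (lsubmx z) (c (tau z) (rsubmx z) s).
have fZ : flow_of Z Phi.
  split.
  - move=> j; case: (split_ordP j) => i ->.
      have -> : (fun z => Z z 0 (lshift n i)) = fun=> 0.
        by apply/funext => z; rewrite row_mxEl mxE.
      exact: smooth_cst.
    have -> : (fun z => Z z 0 (rshift 1 i)) = fun z => tau z * Y (rsubmx z) 0 i.
      by apply/funext => z; rewrite row_mxEr mxE.
    apply: smoothM; first exact: smooth_coord.
    exact: smooth_rsubmx_comp (Y_smooth i).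
  - by move=> z; rewrite /Phi c0 hsubmxK.
  - move=> z s s01 j.
    have -> : Z (Phi z s) = row_mx 0 (tau z *: Y (c (tau z) (rsubmx z) s)).
      by rewrite /Z /Phi row_mxKr /tau row_mxEl mxE.
    case: (split_ordP j) => i ->.
      have -> : (fun u => Phi z u 0 (lshift n i)) = cst (lsubmx z 0 i).
        by apply/funext => u; rewrite row_mxEl.
      have -> : row_mx 0 (tau z *: Y (c (tau z) (rsubmx z) s)) 0 (lshift n i) = 0 :> R.
        by rewrite row_mxEl mxE.
      exact: is_derive_cst.
    have -> : (fun u => Phi z u 0 (rshift 1 i)) = fun u => c (tau z) (rsubmx z) u 0 i.
      by apply/funext => u; rewrite row_mxEr.
    by rewrite row_mxEr; exact: dc.
  (* The velocity is at most [s * B], which is Gronwall's hypothesis with [L = 0]. *)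
  - move=> s; have [K K0 HK] := @gronwall R n 0 (lexx _).
    exists (s + K * (s + s * B)) => z u zs u01.
    have s0 : 0 <= s by exact: le_trans zs.
    have [lz rz] := submx_norm_le z.
    apply: row_mx_norm_le; first exact: le_trans zs.
    apply: le_trans (HK _ _ (s * B) _ (dc _ _) _ u u01) _ => [||].
    - by rewrite mulr_ge0.
    - move=> w _; rewrite mul0r add0r normrZ ler_pM //.
      by apply: le_trans zs; exact: rV_coord_le.
    - by rewrite c0 ler_wpM2l // lerD2r (le_trans rz).
exists (fun t x => c t x 1); split=> [t x|V x t sx st j]; first by exists (c t x).
have -> : (fun p => c (t p) (x p) 1 0 j) =
   (fun z => Phi z 1 0 (rshift 1 j)) \o (fun p => row_mx (const_mx (t p)) (x p)).
  apply/funext => p; rewrite /= /Phi row_mxEr row_mxKr.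
  by rewrite /tau row_mxEl mxE.
apply: smooth_comp; first exact: flow_smooth fZ _.
move=> i; case: (split_ordP i) => k ->.
  have -> : (fun p => row_mx (const_mx (t p) : 'rV_1) (x p) 0 (lshift n k)) = t.
    by apply/funext => p; rewrite row_mxEl mxE.
  exact: st.
have -> : (fun p => row_mx (const_mx (t p) : 'rV_1) (x p) 0 (rshift 1 k)) = fun p => x p 0 k.
  by apply/funext => p; rewrite row_mxEr.
exact: sx.
Qed.

End FlowMap.

(** * Gradients and the Milnor set *)

Section DotProduct.
Context {R : realType} {n : nat}.
Implicit Types (u v w a b : 'rV[R]_n).

Definition dot u v : R := \sum_i u 0 i * v 0 i.

Lemma dotC u v : dot u v = dot v u.
Proof. by apply: eq_bigr => i _; rewrite mulrC. Qed.

Lemma dotBl u v w : dot (u - v) w = dot u w - dot v w.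
Proof. by rewrite /dot -sumrB; apply: eq_bigr => i _; rewrite !mxE mulrBl. Qed.

Lemma dotZl (k : R) u w : dot (k *: u) w = k * dot u w.
Proof. by rewrite /dot mulr_sumr; apply: eq_bigr => i _; rewrite mxE mulrA. Qed.

Lemma dotBr u v w : dot w (u - v) = dot w u - dot w v.
Proof. by rewrite dotC dotBl !(dotC w). Qed.

Lemma dotZr (k : R) u w : dot w (k *: u) = k * dot w u.
Proof. by rewrite dotC dotZl (dotC w). Qed.

Lemma dot0r u : dot u 0 = 0.
Proof. by apply: big1 => i _; rewrite mxE mulr0. Qed.

Lemma dot_ge0 u : 0 <= dot u u.
Proof. by apply: sumr_ge0 => i _; rewrite -expr2 sqr_ge0. Qed.

Lemma dot_eq0 u : (dot u u == 0) = (u == 0).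
Proof.
apply/eqP/eqP => [u0|->]; last exact: dot0r.
apply/rowP => i; rewrite mxE; apply/eqP; rewrite -sqrf_eq0 expr2.
have := u0; rewrite /dot => /eqP; rewrite psumr_eq0.
  by move=> /allP/(_ i); rewrite mem_index_enum => /(_ isT).
by move=> j _; rewrite -expr2 sqr_ge0.
Qed.

Lemma rho0_dot u : rho0 u = dot u u.
Proof.
rewrite /rho0 /enorm sqr_sqrtr; first by apply: eq_bigr => i _; rewrite expr2.
by apply: sumr_ge0 => i _; exact: sqr_ge0.
Qed.

Lemma enorm_rho0 u : enorm u = Num.sqrt (rho0 u).
Proof. by rewrite /rho0 sqrtr_sqr ger0_norm // sqrtr_ge0. Qed.

Lemma norm_sqr_le_rho0 u : `|u| ^+ 2 <= rho0 u.
Proof.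
have u0 : 0 <= dot u u := dot_ge0 u.
rewrite rho0_dot -[leRHS]sqr_sqrtr // ler_sqr ?nnegrE ?sqrtr_ge0 //.
apply: rV_norm_le => [|j]; first exact: sqrtr_ge0.
rewrite -ler_sqr ?nnegrE ?sqrtr_ge0 // sqr_sqrtr // real_normK ?num_real //.
by rewrite /dot (bigD1 j) //= -expr2 lerDl sumr_ge0 // => i _; rewrite -expr2 sqr_ge0.
Qed.

(** A Gram-Schmidt step multiplied by [dot a a]: without division it is polynomial in both vectors
    and makes sense at [a = 0]. *)
Definition reject a u := dot a a *: u - dot a u *: a.

(* Up to a nonnegative factor, the component of [w] orthogonal to [a] and [b]. *)
Definition transverse a b w :=
  dot (reject a b) (reject a b) *: reject a w -
  dot (reject a b) (reject a w) *: reject a b.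

Lemma dot_transverse1 a b w : dot (transverse a b w) a = 0.
Proof.
rewrite /transverse /reject !(dotBl, dotBr, dotZl, dotZr) ?(dotC b a) ?(dotC w a).
ring.
Qed.

Lemma dot_transverse2 a b w : dot (transverse a b w) b = 0.
Proof.
rewrite /transverse /reject !(dotBl, dotBr, dotZl, dotZr) ?(dotC b a) ?(dotC w a) ?(dotC w b).
ring.
Qed.

(** Modulo [a] and [b], to which it is orthogonal, [transverse a b w] is [w] times the displayed
    coefficient. So it vanishes as soon as its product with [w] does. *)
Lemma transverse_sqr a b w : dot (transverse a b w) (transverse a b w) =
  dot (reject a b) (reject a b) * dot a a * dot (transverse a b w) w.
Proof.
rewrite /transverse /reject !(dotBl, dotBr, dotZl, dotZr) ?(dotC b a) ?(dotC w a) ?(dotC w b).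
ring.
Qed.

(** Either [b] is parallel to [a], or [w] lies in the span of [a] and [b]. The dependence is
    expressed through vectors orthogonal to [a] because the Milnor set tests differentials on
    tangent vectors. *)
Lemma transverse_degenerate a b w : a != 0 -> dot (transverse a b w) w = 0 ->
  exists k l : R, (k != 0) || (l != 0) /\
    forall v, dot v a = 0 -> k * dot v b + l * dot v w = 0.
Proof.
move=> a0 Pw; have A0 : dot a a != 0 by rewrite dot_eq0.
have P0 : transverse a b w = 0.
  by apply/eqP; rewrite -dot_eq0 transverse_sqr Pw mulr0.
have [b0|b0] := eqVneq (dot (reject a b) (reject a b)) 0.
  exists 1, 0; rewrite oner_eq0; split=> // v va.
  have : dot v (reject a b) = 0.
    by move/eqP: b0; rewrite dot_eq0 => /eqP ->; rewrite dot0r.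
  rewrite /reject dotBr !dotZr va mulr0 subr0 => /eqP; rewrite mulf_eq0 (negbTE A0) /=.
  by move=> /eqP ->; rewrite mulr0 mul0r addr0.
exists (- dot (reject a b) (reject a w)), (dot (reject a b) (reject a b)).
split=> [|v va]; first by rewrite b0 orbT.
have : dot v (transverse a b w) = 0 by rewrite P0 dot0r.
rewrite /transverse dotBr !dotZr {2 4}/reject !dotBr !dotZr va !mulr0 !subr0 => H.
by apply: (mulfI A0); rewrite mulr0 -[RHS]H; ring.
Qed.

End DotProduct.

Section Gradient.
Context {R : realType} {n : nat}.
Implicit Types (f g : 'rV[R]_n -> R) (x v : 'rV[R]_n).

Lemma gradientE g x i : gradient g x 0 i = pd g i x.
Proof. by rewrite mxE. Qed.

Lemma smooth_gradient g i : smooth g -> smooth (fun x => gradient g x 0 i).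
Proof.
move=> sg; have -> : (fun x => gradient g x 0 i) = pd g i.
  by apply/funext => x; rewrite gradientE.
exact: smooth_derive.
Qed.

Lemma derive_gradient g x v : smooth g -> 'D_v g x = dot v (gradient g x).
Proof.
by move=> sg; rewrite derive_sum_pd //; apply: eq_bigr => i _; rewrite gradientE.
Qed.

Lemma is_derive_along g (c : R -> 'rV[R]_n) (t : R) v : smooth g ->
  (forall j, is_derive t 1 (fun s => c s 0 j) (v 0 j)) ->
  is_derive t 1 (g \o c) (dot v (gradient g (c t))).
Proof.
move=> sg dc.
have -> : dot v (gradient g (c t)) = \sum_j v 0 j * pd g j (c t).
  by apply: eq_bigr => i _; rewrite gradientE.
apply: is_derive_comp_curve => //.
- by move=> j x; exact: smooth_derivable.
- by move=> j; apply: smooth_continuous; exact: smooth_derive.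
Qed.

Lemma smooth_dot (V : normedModType R) (u v : V -> 'rV[R]_n) :
  (forall i, smooth (fun p => u p 0 i)) -> (forall i, smooth (fun p => v p 0 i)) ->
  smooth (fun p => dot (u p) (v p)).
Proof. by move=> su sv; apply: smooth_sum => i; exact: smoothM. Qed.

Lemma smooth_rho0 : smooth (@rho0 R n).
Proof.
have -> : @rho0 R n = fun x => dot x x by apply/funext => x; rewrite rho0_dot.
by apply: smooth_dot => i; exact: smooth_coord.
Qed.

Lemma gradient_rho0 x : gradient (@rho0 R n) x = 2 *: x.
Proof.
have -> : @rho0 R n = \sum_i (fun x => x 0 i ^+ 2).
  by apply/funext => y; rewrite rho0_dot fct_sumE; apply: eq_bigr => i _; rewrite expr2.
apply/rowP => j; rewrite !mxE.
have dc i : is_derive x (delta_mx 0 j) (fun y : 'rV[R]_n => y 0 i ^+ 2)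
    (2 * x 0 i * (delta_mx 0 j : 'rV[R]_n) 0 i).
  exact: (is_derive_sqr (is_derive_coord x (delta_mx 0 j) i)).
rewrite (@derive_val _ _ _ _ _ _ _ (is_derive_sum dc)) (bigD1 j) //= mxE !eqxx mulr1.
rewrite big1 ?addr0 // => i ij; rewrite mxE eqxx (negbTE ij) /= mulr0 //.
Qed.

(** Links directional derivatives to the jacobian in the definition of the Milnor set, which comes
    from the Frechet differential. *)
Lemma smooth_differentiable k (F : 'rV[R]_n -> 'rV[R]_k) x :
  (forall j, smooth (fun y => F y 0 j)) -> differentiable F x.
Proof.
move=> sF.
pose J : 'M[R]_(n, k) := \matrix_(i, j) pd (fun y => F y 0 j) i x.
have mulJ h j : (h *m J) 0 j = \sum_i h 0 i * pd (fun y => F y 0 j) i x.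
  by rewrite mxE; apply: eq_bigr => i _; rewrite mxE.
have cJ : continuous (mulmxr J : 'rV[R]_n -> 'rV[R]_k).
  move=> h; apply/rV_continuousP => j.
  have -> : (fun s : 'rV[R]_n => mulmxr J s 0 j) =
      fun s => \sum_i s 0 i * pd (fun y => F y 0 j) i x.
    by apply/funext => s; exact: mulJ.
  apply: smooth_continuous; apply: smooth_sum => i; apply: smoothM; first exact: smooth_coord.
  exact: smooth_cst.
have E : F \o shift x = cst (F x) + mulmxr J +o_ (0 : 'rV[R]_n) id.
  apply/eqaddoP => e e0 /=.
  have : \forall h \near (0 : 'rV[R]_n), forall j,
      `|F (h + x) 0 j - F x 0 j - (h *m J) 0 j| <= e * `|h|.
    near=> h => j; move: j; near: h; apply: filter_forall => j.
    have [||d d0 hd] := strict_differentiability _ _ e0 (g := fun y => F y 0 j) (p := x).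
    - by move=> i y; exact: smooth_derivable.
    - by move=> i; apply: smooth_continuous; exact: smooth_derive.
    apply/nbhs_ballP; exists d => // h; rewrite -ball_normE /= sub0r normrN => hd'.
    have := hd (h + x) x; rewrite addrK subrr normr0 => /(_ hd' d0).
    by rewrite mulJ; congr (`| _ - _ | <= _); apply: eq_bigr => i _; rewrite !mxE addrK.
  apply: filterS => h H.
  apply: rV_norm_le => [|j]; first by rewrite mulr_ge0 // ltW.
  have := H j; rewrite /= !mxE opprD addrA; congr (`| _ - _ | <= _).
by apply/diff_locallyP; rewrite (diff_unique cJ E).
Unshelve. all: by end_near. Qed.

Lemma tangent_gradient (M : set 'rV[R]_n) g x v : smooth g ->
  M `<=` g @^-1` [set 0] -> tangent M x v -> dot v (gradient g x) = 0.
Proof.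
move=> sg Mg [I [c [[Io I0] sc cM cx cv]]].
have dc := (sc [::] 0 I0).2 1.
have dcj j : is_derive (0 : R) 1 (fun s => c s 0 j) (v 0 j).
  rewrite -cv derive1E derive_mx // mxE; apply: derivableP.
  exact: (derivable_mxP c 0 1).1.
have := is_derive_along sg dcj; rewrite cx => -[_ <-].
rewrite (@near_eq_derive _ _ _ _ (cst 0)) ?derive_cst //.
have : \forall s \near (0 : R), I s by exact: open_nbhs_nbhs.
by apply: filterS => s Is; apply: Mg; apply: cM; exists s.
Qed.

Lemma degenerate_milnor (M : set 'rV[R]_n) f g x : smooth f -> smooth g ->
  M = g @^-1` [set 0] -> M x -> gradient g x <> 0 ->
  dot (transverse (gradient g x) x (gradient f x)) (gradient f x) = 0 ->
  milnor_set M f x.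
Proof.
move=> sf sg ME Mx /eqP g0 /(transverse_degenerate g0)[k [l [kl Hkl]]].
split=> // p V tV; rewrite ltnNge; apply/negP => rk.
set F := pair_map f (@rho0 R n) in rk *; set J := jacobian F x in rk.
have F0 : (fun y => F y 0 0) = f by apply/funext => y; rewrite mxE.
have F1 : (fun y => F y 0 1) = @rho0 R n by apply/funext => y; rewrite mxE.
have sF j : smooth (fun y => F y 0 j).
  have [->|->] : j = 0 \/ j = 1.
    by case: j => -[|[|//]] i; [left|right]; apply/val_inj.
  - by rewrite F0.
  - by rewrite F1; exact: smooth_rho0.
have dF := smooth_differentiable x sF.
have VJ i j : (V *m J) i j = dot (row i V) (gradient (fun y => F y 0 j) x).
  have -> : (V *m J) i j = (row i V *m J) 0 j.
    by rewrite -row_mul [RHS]mxE.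
  rewrite -deriveEjacobian // derive_mx ?mxE; last exact: diff_derivable.
  by rewrite derive_gradient.
have VJ0 i : (V *m J) i 0 = dot (row i V) (gradient f x).
  by rewrite VJ F0.
have VJ1 i : (V *m J) i 1 = 2 * dot (row i V) x.
  by rewrite VJ F1 gradient_rho0 dotZr.
(* The columns of [V *m J] are the products with [gradient f x] and with [2 *: x]; twice the
   relation given by [k] and [l] is thus a kernel vector. *)
pose q : 'cV[R]_2 := \col_j (if j == 0 then 2 * l else k).
have Vq : V *m J *m q = 0.
  apply/colP => i; rewrite mxE !big_ord_recl big_ord0 addr0 [RHS]mxE.
  have tv : dot (row i V) (gradient g x) = 0.
    by apply: (tangent_gradient sg _ (tV i)); rewrite ME.
  have -> : lift ord0 ord0 = 1 :> 'I_2 by apply/val_inj.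
  rewrite VJ0 VJ1 !mxE /=; have := Hkl _ tv; lra.
have rf : row_free (V *m J)^T.
  by rewrite /row_free mxrank_tr eqn_leq rank_leq_col rk.
have : q^T = 0.
  by apply/eqP; rewrite -(mulmx_free_eq0 _ rf) -trmx_mul Vq trmx0.
move=> /matrixP q0; have := q0 0 0; have := q0 0 1; rewrite !mxE /= => k0 l0.
by move: kl; rewrite k0 eqxx /=; apply/negP; rewrite negbK; apply/eqP; lra.
Qed.

End Gradient.

(** * The transverse field *)

Section TransverseField.
Context {R : realType} {n : nat}.
Variables (f g : 'rV[R]_n -> R).
Hypotheses (f_smooth : smooth f) (g_smooth : smooth g).

Definition direction (x : 'rV[R]_n) := transverse (gradient g x) x (gradient f x).

Definition rate (x : 'rV[R]_n) := dot (direction x) (gradient f x).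

(* A complete substitute for [direction x / rate x], with which it agrees where
   [rho0 x <= a] and [d <= rate x ^+ 2]. *)
Definition field (a d : R) (x : 'rV[R]_n) :=
  (cutoff a (rho0 x) * (rate x / (rate x ^+ 2 + flat 1 (d - rate x ^+ 2)))) *: direction x.

Lemma smooth_direction i : smooth (fun x => direction x 0 i).
Proof.
have sa j := smooth_gradient j g_smooth.
have sb (j : 'I_n) : smooth (fun x : 'rV[R]_n => x 0 j) := smooth_coord j.
have sw j := smooth_gradient j f_smooth.
have sr (u : 'rV[R]_n -> 'rV[R]_n) : (forall j, smooth (fun x => u x 0 j)) ->
    forall j, smooth (fun x => reject (gradient g x) (u x) 0 j).
  move=> su j.
  have -> : (fun x => reject (gradient g x) (u x) 0 j) = fun x =>
      dot (gradient g x) (gradient g x) * u x 0 j - dot (gradient g x) (u x) * gradient g x 0 j.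
    by apply/funext => x; rewrite !mxE.
  by apply: smoothB; apply: smoothM => //; exact: smooth_dot.
have -> : (fun x => direction x 0 i) = fun x =>
    dot (reject (gradient g x) x) (reject (gradient g x) x) *
      reject (gradient g x) (gradient f x) 0 i -
    dot (reject (gradient g x) x) (reject (gradient g x) (gradient f x)) *
      reject (gradient g x) x 0 i.
  apply/funext => x; rewrite /direction /transverse.
  set u := reject _ _; set v := reject _ _; by rewrite !mxE.
have s1 := sr _ sb; have s2 := sr _ sw.
by apply: smoothB; apply: smoothM => //; exact: smooth_dot.
Qed.

Lemma smooth_rate : smooth rate.
Proof.
by apply: smooth_dot => i; [exact: smooth_direction|exact: smooth_gradient].
Qed.

(** The term in [flat] is positive exactly when [x ^ 2 < d], hence at the zero of [x ^ 2]; it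
    disappears for [d <= x ^ 2], where [x] over this denominator is just [1 / x]. *)
Lemma rate_den_gt0 (d x : R) : 0 < d -> 0 < x ^+ 2 + flat 1 (d - x ^+ 2).
Proof.
move=> d0; have [->|x0] := eqVneq x 0.
  by rewrite expr0n /= subr0 add0r flat1_gt0.
by rewrite ltr_pwDl ?flat1_ge0 // exprn_even_gt0.
Qed.

Lemma smooth_field (a d : R) : 0 < d -> smooth_coords (field a d).
Proof.
move=> d0 i.
have -> : (fun x => field a d x 0 i) = fun x => cutoff a (rho0 x) *
    (rate x / (rate x ^+ 2 + flat 1 (d - rate x ^+ 2))) * direction x 0 i.
  by apply/funext => x; rewrite mxE.
have sX := smoothX 2 smooth_rate.
apply: smoothM; last exact: smooth_direction.
apply: smoothM; first exact: smooth_cutoff smooth_rho0.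
apply: smoothM; first exact: smooth_rate.
apply: smoothV => [x|]; first by rewrite gt_eqF // rate_den_gt0.
apply: smoothD => //.
apply: (smooth_comp1 (c := fun x => d - rate x ^+ 2)); first exact: smooth_flat.
by apply: smoothB => //; exact: smooth_cst.
Qed.

Lemma field_support (a d : R) x : `|a| + 1 < `|x| -> field a d x = 0.
Proof.
move=> ax; rewrite /field cutoff_eq0 ?mul0r ?scale0r //.
(* The sup norm is at most the Euclidean norm, and [(|a| + 1) ^ 2 >= a + 1]. *)
apply: le_trans (norm_sqr_le_rho0 x); have := ler_norm a; have := normr_ge0 a; nra.
Qed.

Lemma dot_field (a d : R) x u : dot (field a d x) u =
  cutoff a (rho0 x) * (rate x / (rate x ^+ 2 + flat 1 (d - rate x ^+ 2))) *
  dot (direction x) u.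
Proof. by rewrite dotZl. Qed.

(** The product is the cut-off times [rate x ^ 2] over its regularization, both between 0 and 1. *)
Lemma field_f (a d : R) x : 0 < d -> 0 <= dot (field a d x) (gradient f x) <= 1.
Proof.
move=> d0; rewrite dot_field -/(rate x).
have -> : cutoff a (rho0 x) * (rate x / (rate x ^+ 2 + flat 1 (d - rate x ^+ 2))) * rate x =
    cutoff a (rho0 x) * (rate x ^+ 2 / (rate x ^+ 2 + flat 1 (d - rate x ^+ 2))).
  by set q := (_ + flat _ _)^-1; ring.
have D0 := rate_den_gt0 (rate x) d0.
have q0 : 0 <= rate x ^+ 2 / (rate x ^+ 2 + flat 1 (d - rate x ^+ 2)).
  by rewrite divr_ge0 ?sqr_ge0 // ltW.
have q1 : rate x ^+ 2 / (rate x ^+ 2 + flat 1 (d - rate x ^+ 2)) <= 1.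
  by rewrite ler_pdivrMr // mul1r lerDl flat1_ge0.
have /andP[c0 c1] : 0 <= cutoff a (rho0 x) <= 1.
  have f0 s : 0 <= flat (1 : {poly R}) s := flat1_ge0 s.
  have den := cutoff_den a (rho0 x).
  have den0 : 0 < flat 1 (a + 1 - rho0 x) + flat 1 (rho0 x - a).
    by rewrite lt_neqAle eq_sym den addr_ge0.
  by rewrite /cutoff divr_ge0 ?(ltW den0) //= ler_pdivrMr // mul1r lerDl.
by rewrite mulr_ge0 //= mulr_ile1.
Qed.

Lemma field_eq (a d : R) x : 0 < d -> rho0 x <= a -> d <= rate x ^+ 2 ->
  field a d x = (rate x)^-1 *: direction x.
Proof.
move=> d0 xa dx; rewrite /field cutoff_eq1 // mul1r.
have -> : flat 1 (d - rate x ^+ 2) = 0 by apply/eqP; rewrite flat1_eq0 subr_le0.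
have r0 : rate x != 0 by rewrite -sqrf_eq0 gt_eqF // (lt_le_trans d0).
by rewrite addr0 expr2 invfM mulrA divff // mul1r.
Qed.

Section Trajectory.
Variables (a d t : R) (c : R -> 'rV[R]_n).
Hypotheses (d0 : 0 < d) (dc : has_velocity c (fun s => t *: field a d (c s))).

Lemma is_derive_trajectory (h : 'rV[R]_n -> R) (s : R) : smooth h -> 0 <= s <= 1 ->
  is_derive s 1 (h \o c) (t * dot (field a d (c s)) (gradient h (c s))).
Proof. by move=> sh s01; rewrite -dotZl; apply: is_derive_along => //; exact: dc. Qed.

(** The field is a multiple of [direction] everywhere, so whatever [direction] annihilates is
    conserved, even where the field has been cut off. *)
Lemma first_integral (h : 'rV[R]_n -> R) (s : R) : smooth h ->
  (forall x, dot (direction x) (gradient h x) = 0) -> 0 <= s <= 1 ->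
  h (c s) = h (c 0).
Proof.
move=> sh h0 s01; apply/eqP; rewrite -subr_eq0 -normr_le0.
apply: (@norm_le_of_derive _ (fun s => h (c s) - h (c 0)) (fun=> 0) (fun=> 0) (fun=> 0)) => //.
- move=> u u01; rewrite -[X in is_derive _ _ _ X](subr0 0).
  have := is_derive_trajectory sh u01; rewrite dot_field h0 !mulr0 => H.
  exact: (is_deriveB H (is_derive_cst (h (c 0)) u 1)).
- by move=> u _; rewrite normr0.
- by rewrite subrr normr0.
Qed.

Lemma trajectory_g (s : R) : 0 <= s <= 1 -> g (c s) = g (c 0).
Proof. by apply: first_integral => // x; exact: dot_transverse1. Qed.

Lemma trajectory_rho0 (s : R) : 0 <= s <= 1 -> rho0 (c s) = rho0 (c 0).
Proof.
apply: first_integral => [|x]; first exact: smooth_rho0.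
by rewrite gradient_rho0 dotZr /direction dot_transverse2 mulr0.
Qed.

(** For [t >= 0] both [f] and [t * s - f] are nondecreasing along the trajectory; for [t <= 0] both
    are nonincreasing. *)
Lemma trajectory_f_le (s : R) : 0 <= s <= 1 ->
  Num.min 0 t <= f (c s) - f (c 0) <= Num.max 0 t.
Proof.
move=> s01.
pose q u := dot (field a d (c u)) (gradient f (c u)).
have dfc (u : R) : 0 <= u <= 1 -> is_derive u 1 (f \o c) (t * q u).
  by move=> u01; exact: is_derive_trajectory.
have dtf (u : R) : 0 <= u <= 1 -> is_derive u 1 (fun u => t * u - (f \o c) u) (t - t * q u).
  by move=> u01; exact: is_deriveB (is_derive_mull t u) (dfc u u01).
have dNfc (u : R) : 0 <= u <= 1 -> is_derive u 1 (fun u => - (f \o c) u) (- (t * q u)).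
  by move=> u01; exact: is_deriveN (dfc u u01).
have dNtf (u : R) : 0 <= u <= 1 ->
    is_derive u 1 (fun u => (f \o c) u - t * u) (t * q u - t).
  by move=> u01; exact: is_deriveB (dfc u u01) (is_derive_mull t u).
have q01 u : 0 <= q u <= 1 by exact: field_f.
have [t0|/ltW t0] := leP 0 t.
- have := nondecreasing_from0 dfc _ s01; have := nondecreasing_from0 dtf _ s01.
  rewrite /= mulr0 => H1 H2.
  have {}H1 : 0 - f (c 0) <= t * s - f (c s).
    by apply: H1 => u _; have /andP[? ?] := q01 u; nra.
  have {}H2 : f (c 0) <= f (c s).
    by apply: H2 => u _; have /andP[? ?] := q01 u; nra.
  by move: s01 => /andP[s0 s1]; apply/andP; split; nra.
- have := nondecreasing_from0 dNfc _ s01; have := nondecreasing_from0 dNtf _ s01.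
  rewrite /= mulr0 => H1 H2.
  have {}H1 : f (c 0) - 0 <= f (c s) - t * s.
    by apply: H1 => u _; have /andP[? ?] := q01 u; nra.
  have {}H2 : - f (c 0) <= - f (c s).
    by apply: H2 => u _; have /andP[? ?] := q01 u; nra.
  by move: s01 => /andP[s0 s1]; apply/andP; split; nra.
Qed.

Variables (lambda e : R).
Hypotheses (f0 : `|f (c 0) - lambda| <= e) (f1 : `|f (c 0) + t - lambda| <= e).

(** The value of [f] stays between the initial one and the intended final one, both within [e] of
    [lambda]; this is known before the final value is shown to be reached. *)
Lemma trajectory_f_near (s : R) : 0 <= s <= 1 -> `|f (c s) - lambda| <= e.
Proof.
move=> /trajectory_f_le /andP[]; have := f1; have := f0; rewrite !ler_norml.
move=> /andP[? ?] /andP[? ?]; case: (leP 0 t) => ? ? ?; apply/andP; split; lra.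
Qed.

Hypotheses (ca : rho0 (c 0) <= a)
  (rate_ge : forall x, g x = g (c 0) -> rho0 x = rho0 (c 0) -> `|f x - lambda| <= e ->
     d <= rate x ^+ 2).

Lemma trajectory_field (s : R) : 0 <= s <= 1 ->
  field a d (c s) = (rate (c s))^-1 *: direction (c s) /\ rate (c s) != 0.
Proof.
move=> s01; have dr : d <= rate (c s) ^+ 2.
  by apply: rate_ge; [exact: trajectory_g|exact: trajectory_rho0|exact: trajectory_f_near].
split; last by rewrite -sqrf_eq0 gt_eqF // (lt_le_trans d0).
by apply: field_eq => //; rewrite trajectory_rho0.
Qed.

Lemma trajectory_f : f (c 1) = f (c 0) + t.
Proof.
have H01 : 0 <= (1 : R) <= 1 by rewrite ler01 lexx.
apply/eqP; rewrite -subr_eq0 -normr_le0.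
have -> : f (c 1) - (f (c 0) + t) = f (c 1) - t * 1 - f (c 0) by ring.
apply: (@norm_le_of_derive _ (fun s => f (c s) - t * s - f (c 0))
  (fun=> 0) (fun=> 0) (fun=> 0)) => //.
- move=> u u01; have [E r0] := trajectory_field u01.
  have := is_derive_trajectory f_smooth u01; rewrite E dotZl -/(rate (c u)) mulVf // mulr1 => H.
  have := is_deriveB (is_deriveB H (is_derive_mull t u)) (is_derive_cst (f (c 0)) u 1).
  by rewrite subrr subr0.
- by move=> u _; rewrite normr0.
- by rewrite mulr0 subr0 subrr normr0.
Qed.

End Trajectory.

(** By compactness of the set cut out by these non-strict inequalities. The bound depends on [a],
    which is why a family of fields is used. *)
Lemma rate_lower_bound (lambda e r a : R) :
  (forall x, g x = 0 -> `|f x - lambda| <= e -> r <= rho0 x -> rate x != 0) ->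
  exists2 d, 0 < d & forall x, g x = 0 -> `|f x - lambda| <= e -> r <= rho0 x ->
    rho0 x <= a -> d <= rate x ^+ 2.
Proof.
move=> rate0.
pose K := [set x | g x = 0 /\ `|f x - lambda| <= e /\ r <= rho0 x /\ rho0 x <= a].
(* An empty set has no minimum to take; there any positive [d] will do. *)
have [[x0 Kx0]|K0] := pselect (K !=set0); last first.
  by exists 1 => // x gx fx rx xa; exfalso; apply: K0; exists x.
have cg := smooth_continuous g_smooth.
have cf := smooth_continuous f_smooth.
have crho := smooth_continuous (@smooth_rho0 R n).
have cK : compact K.
  apply: bounded_closed_compact.
    exists (`|a| + 1); split; first exact: num_real.
    move=> s sa x [_ [_ [_ xa]]]; apply/ltW/(le_lt_trans _ sa); rewrite leNgt; apply/negP => ax.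
    have := norm_sqr_le_rho0 x; have := ler_norm a; have := normr_ge0 a; nra.
  apply: closedI.
    by apply: (@closed_comp _ _ g [set 0]) => [x _|]; [exact: cg|exact: closed_eq].
  apply: closedI.
    apply: (@closed_comp _ _ (fun x => `|f x - lambda|) [set s | s <= e]); last exact: closed_le.
    move=> x _; apply: (@continuous_comp _ _ _ (fun x => f x - lambda));
      last exact: norm_continuous.
    by apply: smooth_continuous; apply: smoothB => //; exact: smooth_cst.
  apply: closedI.
    apply: (@closed_comp _ _ (@rho0 R n) [set s | r <= s]); last exact: closed_ge.
    by move=> x _; exact: crho.
  apply: (@closed_comp _ _ (@rho0 R n) [set s | s <= a]); last exact: closed_le.
  by move=> x _; exact: crho.
have [||z Kz zmin] := @EVT_min_rV R n (fun x => rate x ^+ 2) K _ cK.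
- by exists x0.
- apply: continuous_subspaceT; apply: smooth_continuous.
  exact: smoothX smooth_rate.
have [gz [fz [rz za]]] : K z by rewrite inE in Kz.
exists (rate z ^+ 2); first by rewrite exprn_even_gt0 //= rate0.
by move=> x gx fx rx xa; apply: zmin; rewrite inE.
Qed.

End TransverseField.

(** * The fibration *)

Lemma smooth_fst_coord (R : realType) n (j : 'I_n) :
  smooth (fun p : 'rV[R]_n * R => p.1 0 j).
Proof.
apply: smooth_linear => [p|a u v]; last by rewrite !mxE.
apply: (@continuous_comp _ _ _ fst (fun x : 'rV[R]_n => x 0 j)); first exact: cvg_fst.
exact: coord_continuous.
Qed.

Theorem theorem4p1 (R : realType) (n : nat) (f g : 'rV[R]_n -> R)
    (M : set 'rV[R]_n) (lambda : R)
    (f_smooth : smooth_on setT f) (g_smooth : smooth_on setT g)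
    (g_regular : forall x, g x = 0 -> gradient g x <> 0)
    (M_def : M = g @^-1` [set 0])
    (lambda_regular : rho0_regular_at_infinity M f lambda) :
  exists (U : set R) (r : R), [/\ open_nbhs lambda U, 0 < r &
    trivial_fibration ((M `&` f @^-1` U) `\` cball M r)
      ((M `&` f @^-1` [set lambda]) `\` cball M r) U f].
Proof.
have sf : smooth f := Smooth f_smooth.
have sg : smooth g := Smooth g_smooth.
have [U0 [r [U0o r0 reg]]] := lambda_regular.
(* A closed interval, because the lower bound on [rate] rests on compactness. *)
have [e e0 Ue] : exists2 e, 0 < e & forall s, `|s - lambda| <= e -> U0 s.
  have /nbhs_ballP[e /= e0 He] := open_nbhs_nbhs U0o.
  exists (e / 2); first by rewrite divr_gt0.
  by move=> s se; apply: He; rewrite -ball_normE /= distrC; lra.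
have rate0 x : g x = 0 -> `|f x - lambda| <= e -> r ^+ 2 <= rho0 x -> rate f g x != 0.
  move=> gx fx rx; apply/eqP => x0; apply: (reg x).
  - by split; [rewrite M_def|exact: Ue].
  - rewrite enorm_rho0; have -> : r = Num.sqrt (r ^+ 2) by rewrite sqrtr_sqr ger0_norm // ltW.
    exact: ler_wsqrtr.
  - apply: (degenerate_milnor sf sg M_def) => //; last exact: g_regular.
    by rewrite M_def.
pose d a := s2val (cid2 (rate_lower_bound sf sg a rate0)).
have d0 a : 0 < d a by rewrite /d; case: cid2.
have dP a x : g x = 0 -> `|f x - lambda| <= e -> r ^+ 2 <= rho0 x -> rho0 x <= a ->
    d a <= rate f g x ^+ 2.
  by rewrite /d; case: cid2 => /= d' _; exact.
pose Y a := field f g a (d a).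
have sY a : smooth_coords (Y a) := smooth_field sf sg a (d0 a).
have Ysupp a x : `|a| + 1 < `|x| -> Y a x = 0 by exact: field_support.
pose E a := sval (cid (flow_map_exists (sY a) (Ysupp a))).
have Etraj a t x : exists c, [/\ c 0 = x, c 1 = E a t x &
    has_velocity c (fun s => t *: Y a (c s))].
  by rewrite /E; case: cid => E' /= [].
have Esmooth a (V : normedModType R) (x : V -> 'rV[R]_n) (t : V -> R) :
    (forall i, smooth (fun p => x p 0 i)) -> smooth t ->
    forall j, smooth (fun p => E a (t p) (x p) 0 j).
  exact: (svalP (cid (flow_map_exists (sY a) (Ysupp a)))).2.
(* One statement for both directions: [t] is [lambda - f x] on the way to the fibre, and
   [s - lambda] on the way from it to the level [s]. *)
have key x t a : g x = 0 -> `|f x - lambda| <= e -> `|f x + t - lambda| <= e ->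
    r ^+ 2 <= rho0 x -> rho0 x <= a ->
    [/\ g (E a t x) = 0, rho0 (E a t x) = rho0 x, f (E a t x) = f x + t,
        E a (- t) (E a t x) = x & forall b, rho0 x <= b -> E b t x = E a t x].
  move=> gx fx ft rx xa.
  have [c [c0 c1 dc]] := Etraj a t x.
  have H01 : 0 <= (1 : R) <= 1 by rewrite ler01 lexx.
  have ge_d b y : rho0 x <= b -> g y = g x -> rho0 y = rho0 x -> `|f y - lambda| <= e ->
      d b <= rate f g y ^+ 2.
    by move=> xb gy ry fy; apply: dP => //; rewrite ?gy ?ry.
  have gc := trajectory_g sg dc H01.
  have rc := trajectory_rho0 dc H01.
  rewrite c0 c1 gx in gc; rewrite c0 c1 in rc.
  have fc : f (E a t x) = f x + t.
    have := @trajectory_f _ _ f g sf sg a (d a) t c (d0 a) dc lambda e.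
    by rewrite c0 c1; apply=> // y; exact: ge_d.
  split=> // [|b xb].
    have [c' [c'0 c'1 dc']] := Etraj a (- t) (E a t x).
    (* The same trajectory run backwards solves the equation for [- t] and ends at [x]. *)
    have dr : has_velocity (fun s => c (1 - s)) (fun s => - t *: Y a (c (1 - s))).
      move=> s s01 j; rewrite scaleNr; exact: (has_velocity_rev dc s01 j).
    have := trajectory_unique (sY a) (Ysupp a) dc' dr.
    by rewrite c'0 c'1 subr0 subrr c0 c1 => ->.
  have [c' [c'0 c'1 dc']] := Etraj b t x.
  (* The trajectory of [Y b] keeps to the region where [Y a] and [Y b] coincide, so it is also a
     trajectory of [Y a]. *)
  have dc'a : has_velocity c' (fun s => t *: Y a (c' s)).
    move=> s s01 j.
    have -> : Y a (c' s) = Y b (c' s).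
      have gc' := trajectory_g sg dc' s01.
      have rc' := trajectory_rho0 dc' s01.
      have fc' : `|f (c' s) - lambda| <= e.
        by apply: (trajectory_f_near sf (d0 b) dc') => //; rewrite c'0.
      rewrite c'0 in gc' rc'.
      by rewrite /Y !field_eq // ?rc' //; exact: ge_d.
    exact: dc'.
  by rewrite -c'1 -c1; apply: (trajectory_unique (sY a) (Ysupp a) dc'a dc); rewrite c0.
pose U := [set s : R | `|s - lambda| < e].
have mem V x : ((M `&` f @^-1` V) `\` cball M r) x <->
    [/\ g x = 0, V (f x) & r < enorm x].
  rewrite M_def; split.
    by move=> [[gx Vx] rx]; split=> //; rewrite ltNge; apply/negP => xr; apply: rx.
  by move=> [gx Vx rx]; split=> // -[_]; rewrite leNgt rx.
have enorm_rho x : r < enorm x -> r ^+ 2 <= rho0 x.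
  move=> rx; rewrite /rho0 ler_sqr ?nnegrE ?(ltW r0) ?(ltW rx) //.
  exact: le_trans (ltW r0) (ltW rx).
have lam0 : `|lambda - lambda| <= e by rewrite subrr normr0 ltW.
exists U, r; split=> //.
  split; last by rewrite /U /= subrr normr0.
  apply: (@open_comp _ _ (fun s => `|s - lambda|) [set s | s < e]); last exact: open_lt.
  move=> s _; apply: (@continuous_comp _ _ _ (fun s => s - lambda)); last exact: norm_continuous.
  by apply: continuousB; [exact: cvg_id|exact: cst_continuous].
(* [rho0 x] is the least admissible parameter; by [key] any larger one gives the same point. *)
exists (fun x => (E (rho0 x) (lambda - f x) x, f x)); split=> //.
have A1 x a : ((M `&` f @^-1` U) `\` cball M r) x -> rho0 x <= a ->
    [/\ g (E a (lambda - f x) x) = 0, rho0 (E a (lambda - f x) x) = rho0 x,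
      f (E a (lambda - f x) x) = lambda,
      E a (f x - lambda) (E a (lambda - f x) x) = x &
      forall b, rho0 x <= b -> E b (lambda - f x) x = E a (lambda - f x) x].
  move=> /mem[gx fx rx] xa; have := key x (lambda - f x) a.
  by rewrite subrKC opprB; apply=> //; [exact: ltW|exact: enorm_rho].
have A2 y t a : ((M `&` f @^-1` [set lambda]) `\` cball M r) y -> U t -> rho0 y <= a ->
    [/\ g (E a (t - lambda) y) = 0, rho0 (E a (t - lambda) y) = rho0 y,
      f (E a (t - lambda) y) = t,
      E a (lambda - t) (E a (t - lambda) y) = y &
      forall b, rho0 y <= b -> E b (t - lambda) y = E a (t - lambda) y].
  move=> /mem[gy fy ry] Ut ya; have := key y (t - lambda) a.
  by rewrite fy subrKC opprB; apply=> //; [exact: ltW|exact: enorm_rho].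
exists (fun p => E (rho0 p.1) (p.2 - lambda) p.1); split.
- move=> x Ax; have [gE rE fE _ _] := A1 x _ Ax (lexx _).
  have /mem[_ Ux rx] := Ax; split; last exact: Ux.
  apply: (mem [set lambda] _).2; split=> //.
  by rewrite enorm_rho0 rE -enorm_rho0.
- move=> [y t] [/= Fy Ut]; have [gE rE fE _ _] := A2 y t _ Fy Ut (lexx _).
  have [_ _ ry] := (mem [set lambda] y).1 Fy; apply: (mem U _).2; split=> //; first by rewrite fE.
  by rewrite enorm_rho0 rE -enorm_rho0.
- move=> x; rewrite inE => Ax /=; have [_ rE _ EE _] := A1 x _ Ax (lexx _).
  by rewrite rE.
- move=> [y t]; rewrite inE => -[/= Fy Ut]; have [_ rE fE EE _] := A2 y t _ Fy Ut (lexx _).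
  by rewrite rE fE EE.
have rho_open a : open [set x : 'rV[R]_n | rho0 x < a].
  apply: (@open_comp _ _ (@rho0 R n) [set s | s < a]); last exact: open_lt.
  by move=> x _; apply: smooth_continuous; exact: smooth_rho0.
split.
(* The bound [d a] was obtained by choice, so nothing is known about how [E a] depends on [a].
   Freezing [a] above [rho0 x] leaves the map unchanged on the part of the domain where
   [rho0 z < a], a neighbourhood of [x]. *)
- move=> x Ax; pose a := rho0 x + 1.
  exists [set z | rho0 z < a], (fun z => (E a (lambda - f z) z, f z)); split.
  + by split; [exact: rho_open|rewrite /= ltrDl].
  + apply: smooth_smooth_on; apply: smooth_pair => //; apply: smooth_rV => j.
    apply: Esmooth; first by move=> i; exact: smooth_coord.
    exact: (smoothB (smooth_cst lambda) sf).
  + move=> z; rewrite inE => -[Az /= za]; have [_ _ _ _ ->] := A1 z a Az (ltW za) => //.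
- move=> [y t] [/= Fy Ut]; pose a := rho0 y + 1.
  exists [set p | rho0 p.1 < a], (fun p => E a (p.2 - lambda) p.1); split.
  + split; last by rewrite /= ltrDl.
    apply: (@open_comp _ _ fst [set x : 'rV[R]_n | rho0 x < a]); last exact: rho_open.
    by move=> p _; exact: cvg_fst.
  + apply: smooth_smooth_on; apply: smooth_rV => j.
    apply: Esmooth; first exact: smooth_fst_coord.
    exact: (smoothB (@smooth_snd R _ _) (smooth_cst lambda)).
  + move=> [z s]; rewrite inE => -[[/= Fz Us] /= za].
    by have [_ _ _ _ ->] := A2 z s a Fz Us (ltW za).
Qed.
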